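(* Let $P_t$ evolve by the Fokker--Planck equation $\partial_tP_t=-\nabla\cdot(\boldsymbol\nu_tP_t)$ on $\mathbb R^d$ with mean local velocity $\boldsymbol\nu_t=\mu(\boldsymbol F_t-T\nabla\ln P_t)$, and let $\mathbb P$ be the forward path probability density over the time step from $\tau$ to $\tau+dt$. Assume that $P_\tau(\boldsymbol x_\tau)$ decays sufficiently rapidly at infinity. Then the excess entropy production rate and the housekeeping entropy production rate are given by $$\sigma^{\rm ex}_\tau=\lim_{dt\to0}\ \inf_{\mathbb Q\in\mathcal M_{\rm ZD}(\mathbb P)}\frac{4D_{\rm KL}(\mathbb P\|\mathbb Q)}{dt},\qquad \sigma^{\rm hk}_\tau=\lim_{dt\to0}\ \inf_{\mathbb Q\in\mathcal M_{\rm G}(\mathbb P)}\frac{4D_{\rm KL}(\mathbb P\|\mathbb Q)}{dt},$$ where $\mathcal M_{\rm ZD}(\mathbb P)=\{\mathbb P^1_{\boldsymbol v}\mid\nabla\cdot(\boldsymbol v(\boldsymbol x_\tau)P_\tau(\boldsymbol x_\tau))=0\}$ is the zero-divergence manifold and $\mathcal M_{\rm G}(\mathbb P)=\{\mathbb P^1_{\nabla r}\mid r(\boldsymbol x_\tau)\in\mathbb R\}$ is the gradient manifold.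
   Context: $\mu>0$, $T>0$ are constants and $\boldsymbol F_t:\mathbb R^d\to\mathbb R^d$ is a force field. For a vector field $\boldsymbol v$ on $\mathbb R^d$ and a time step $dt>0$, $\mathbb P^1_{\boldsymbol v}(\boldsymbol x_{\tau+dt},\boldsymbol x_\tau)=\mathbb T^1_{\tau;\boldsymbol v}(\boldsymbol x_{\tau+dt}\mid\boldsymbol x_\tau)P_\tau(\boldsymbol x_\tau)$ with $$\mathbb T^1_{\tau;\boldsymbol v}(\boldsymbol x_{\tau+dt}\mid\boldsymbol x_\tau)=\frac1{(4\pi\mu T\,dt)^{d/2}}\exp\Big[-\frac{\|\boldsymbol x_{\tau+dt}-\boldsymbol x_\tau-\mu\boldsymbol F_\tau(\boldsymbol x_\tau)dt-[\boldsymbol v(\boldsymbol x_\tau)-\boldsymbol\nu_\tau(\boldsymbol x_\tau)]dt\|^2}{4\mu T\,dt}\Big].$$ The forward path probability density is $\mathbb P=\mathbb P^1_{\boldsymbol\nu_\tau}$, i.e. $\mathbb P(\boldsymbol x_{\tau+dt},\boldsymbol x_\tau)=\mathbb T_\tau(\boldsymbol x_{\tau+dt}\mid\boldsymbol x_\tau)P_\tau(\boldsymbol x_\tau)$ with $\mathbb T_\tau(\cdot\mid\boldsymbol x_\tau)$ the Gaussian density of mean $\boldsymbol x_\tau+\mu\boldsymbol F_\tau(\boldsymbol x_\tau)dt$ and covariance $2\mu T\,dt\,I$. $D_{\rm KL}(\mathbb P\|\mathbb Q)=\int\mathbb P\ln(\mathbb P/\mathbb Q)$ is the Kullback--Leibler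 divergence. The rates are defined by $\sigma_\tau=\frac1{\mu T}\int d\boldsymbol x\,\|\boldsymbol\nu_\tau\|^2P_\tau$, $\sigma^{\rm ex}_\tau=\frac1{\mu T}\lim_{\Delta t\to0}[\mathcal W_2(P_\tau,P_{\tau+\Delta t})]^2/(\Delta t)^2$ with $\mathcal W_2$ the $L^2$-Wasserstein distance, and $\sigma^{\rm hk}_\tau=\sigma_\tau-\sigma^{\rm ex}_\tau$. There is an optimal mean local velocity $\boldsymbol\nu^*_\tau=\nabla\phi_\tau$ with $\partial_\tau P_\tau=-\nabla\cdot(P_\tau\nabla\phi_\tau)$ and $\lim_{\Delta t\to0}[\mathcal W_2(P_\tau,P_{\tau+\Delta t})]^2/(\Delta t)^2=\int d\boldsymbol x\,\|\boldsymbol\nu^*_\tau\|^2P_\tau$. ''Decays sufficiently rapidly at infinity'' means that boundary terms at infinity in integrations by parts against $P_\tau$ vanish. Functions and vector fields are taken regular enough that all displayed expressions are defined. *)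

(* Defs.v *)
From HB Require Import structures.
From mathcomp Require Import all_boot all_order all_algebra.
From mathcomp Require Import all_classical all_reals all_analysis.

Set Implicit Arguments.
Unset Strict Implicit.
Unset Printing Implicit Defensive.
Import Order.TTheory GRing.Theory Num.Theory.
Import numFieldNormedType.Exports.

Local Open Scope classical_set_scope.
Local Open Scope ring_scope.

(* The sigma-algebra generated by the coordinate maps, i.e. the Borel sets of
   R^d. *)
Definition rV_display : measure_display. Proof. exact. Qed.

Section measurable_rV.
Context {R : realType} (d : nat).

Definition rV_coord (i : 'I_d) (x : 'rV[R]_d) : measurableTypeR R := x 0 i.

Let rV_set0 : g_sigma_preimage rV_coord set0.
Proof. exact: sigma_algebra0. Qed.

Let rV_setC A : g_sigma_preimage rV_coord A -> g_sigma_preimage rV_coord (~` A).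
Proof. exact: sigma_algebraC. Qed.

Let rV_bigcup (F : _^nat) : (forall i, g_sigma_preimage rV_coord (F i)) ->
  g_sigma_preimage rV_coord (\bigcup_i (F i)).
Proof. exact: sigma_algebra_bigcup. Qed.

HB.instance Definition _ := @isMeasurable.Build rV_display
  'rV[R]_d (g_sigma_preimage rV_coord) rV_set0 rV_setC rV_bigcup.

End measurable_rV.

Lemma measurable_rV_coord {R : realType} d (i : 'I_d) :
  measurable_fun setT (@rV_coord R d i).
Proof.
move=> _ Y mY; rewrite setTI; apply: sub_sigma_algebra => /=.
rewrite -bigcup_seq/=; exists i => /=; first by rewrite mem_index_enum.
by exists Y => //; rewrite setTI.
Qed.

Lemma measurable_fun_rV {R : realType} d' (T : measurableType d') d
    (f : T -> 'rV[R]_d) :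
  (forall i, measurable_fun setT (rV_coord i \o f)) -> measurable_fun setT f.
Proof.
move=> mf.
have h : g_sigma_preimage (fun i => @rV_coord R d i \o f) `<=` measurable.
  apply: smallest_sub; first exact: sigma_algebra_measurable.
  by rewrite -bigcup_seq; apply: bigcup_sub => i _ A [B mB <-]; exact: mf.
have e := @g_sigma_preimage_comp _ (measurableTypeR R) d _ (@rV_coord R d) _ f.
by move=> _ A mA; apply: h; rewrite e; exists A.
Qed.

Definition rV_cons {R : realType} d (z : measurableTypeR R * 'rV[R]_d) :
    'rV[R]_d.+1 :=
  \row_i (if unlift 0 i is Some j then z.2 0 j else z.1).

Definition rV_uncons {R : realType} d (x : 'rV[R]_d.+1) :
    measurableTypeR R * 'rV[R]_d :=
  (rV_coord 0 x, \row_j x 0 (lift 0 j)).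

Lemma rV_consK {R : realType} d : cancel (@rV_cons R d) (@rV_uncons R d).
Proof.
move=> [a y]; congr pair; first by rewrite /rV_coord mxE unlift_none.
by apply/rowP => j; rewrite !mxE liftK.
Qed.

Lemma measurable_rV_cons {R : realType} d :
  measurable_fun setT (@rV_cons R d).
Proof.
apply: measurable_fun_rV => i.
case: (unliftP 0 i) => [j|] ->.
- rewrite (_ : _ \o _ = rV_coord j \o snd).
    by apply: measurableT_comp => //; exact: measurable_rV_coord.
  by apply/funext => z; rewrite /rV_coord /= mxE liftK.
- rewrite (_ : _ \o _ = fst) //.
  by apply/funext => z; rewrite /rV_coord /= mxE unlift_none.
Qed.

Lemma measurable_rV_uncons {R : realType} d :
  measurable_fun setT (@rV_uncons R d).
Proof.
apply: measurable_fun_pair; first exact: measurable_rV_coord.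
apply: measurable_fun_rV => j.
rewrite (_ : _ \o _ = rV_coord (lift 0 j)); first exact: measurable_rV_coord.
by apply/funext => x; rewrite /rV_coord /= mxE.
Qed.

Section lebesgue_cons.
Context {R : realType} (d : nat).
Variable mu : {sigma_finite_measure set 'rV[R]_d -> \bar R}.
Local Open Scope ereal_scope.

Definition lebesgue_cons : set 'rV[R]_d.+1 -> \bar R :=
  pushforward (@lebesgue_measure R \x mu) (@rV_cons R d).

Let measurable_preimage A :
  measurable A -> measurable (@rV_cons R d @^-1` A).
Proof.
by move=> mA; rewrite -[X in measurable X]setTI; exact: measurable_rV_cons.
Qed.

Let lebesgue_cons0 : lebesgue_cons set0 = 0.
Proof. by rewrite /lebesgue_cons /pushforward preimage_set0 measure0. Qed.

Let lebesgue_cons_ge0 A : 0 <= lebesgue_cons A.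
Proof. by rewrite /lebesgue_cons /pushforward; exact: measure_ge0. Qed.

Let lebesgue_cons_sigma_additive : semi_sigma_additive lebesgue_cons.
Proof.
move=> F mF tF mUF; rewrite /lebesgue_cons /pushforward preimage_bigcup.
apply: measure_semi_sigma_additive.
- by move=> n; exact: measurable_preimage.
- apply/trivIsetP => /= i j _ _ ij; rewrite -preimage_setI.
  by move/trivIsetP : tF => /(_ _ _ _ _ ij) ->//; rewrite preimage_set0.
- by rewrite -preimage_bigcup; exact: measurable_preimage.
Qed.

HB.instance Definition _ := isMeasure.Build _ _ _ lebesgue_cons
  lebesgue_cons0 lebesgue_cons_ge0 lebesgue_cons_sigma_additive.

Let lebesgue_cons_sigma_finite : sigma_finite setT lebesgue_cons.
Proof.
have /sigma_finiteP[F [FT ndF Foo]] := sigma_finiteT (@lebesgue_measure R).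
have /sigma_finiteP[G [GT ndG Goo]] := sigma_finiteT mu.
exists (fun n => @rV_uncons R d @^-1` (F n `*` G n)).
  rewrite -preimage_bigcup (_ : \bigcup_n _ = setT) ?preimage_setT//.
  apply/seteqP; split => // -[a y] _.
  have [n _ Fna] : (\bigcup_n F n) a by rewrite -FT.
  have [k _ Gky] : (\bigcup_n G n) y by rewrite -GT.
  exists (maxn n k) => //; split.
  - by move: a Fna; exact/subsetPset/ndF/leq_maxl.
  - by move: y Gky; exact/subsetPset/ndG/leq_maxr.
move=> n; have [mF Fn] := Foo n; have [mG Gn] := Goo n; split.
  rewrite -[X in measurable X]setTI; apply: measurable_rV_uncons => //.
  exact: measurableX.
rewrite /lebesgue_cons /pushforward -comp_preimage.
rewrite (_ : _ \o _ = id) ?preimage_id; last first.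
  by apply/funext => z; exact: rV_consK.
by rewrite product_measure1E// lte_mul_pinfty// ge0_fin_numE.
Qed.

HB.instance Definition _ := Measure_isSigmaFinite.Build _ _ _ lebesgue_cons
  lebesgue_cons_sigma_finite.

End lebesgue_cons.

(* Lebesgue measure on R^d: the d-fold product of the Lebesgue measure on R
   (a unit mass when d = 0). *)
Fixpoint lebesgue_rV {R : realType} (d : nat) :
    {sigma_finite_measure set 'rV[R]_d -> \bar R} :=
  match d with
  | 0 => \d_(0 : 'rV[R]_0)
  | d'.+1 => lebesgue_cons (@lebesgue_rV R d')
  end.
Arguments lebesgue_rV {R} d.

(* The norm of the library on row vectors is the sup norm. *)
Definition sqnorm {R : realType} d (x : 'rV[R]_d) : R := \sum_i x 0 i ^+ 2.

Definition partial {R : realType} d (i : 'I_d) (f : 'rV[R]_d -> R) :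
  'rV[R]_d -> R := 'D_(delta_mx 0 i) f.

Definition grad {R : realType} d (f : 'rV[R]_d -> R) (x : 'rV[R]_d) :
    'rV[R]_d :=
  \row_i partial i f x.

Definition divergence {R : realType} d (w : 'rV[R]_d -> 'rV[R]_d)
    (x : 'rV[R]_d) : R :=
  \sum_i partial i (fun y => w y 0 i) x.

Definition C1 {R : realType} d (f : 'rV[R]_d -> R) : Prop :=
  (forall x, differentiable f x) /\ (forall i, continuous (partial i f)).

Definition C1_field {R : realType} d (w : 'rV[R]_d -> 'rV[R]_d) : Prop :=
  forall i, C1 (fun x => w x 0 i).

Definition C2 {R : realType} d (f : 'rV[R]_d -> R) : Prop :=
  C1 f /\ C1_field (grad f).

(* The point of R^d with j-th coordinate a and the others given by y. *)
Definition rV_insert {R : realType} d (j : 'I_d) (a : R) (y : 'rV[R]_d.-1) :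
    'rV[R]_d :=
  \row_i (if unlift j i is Some k then y 0 k else a).

(* The outward flux of w through the boundary of the cube [-L, L]^d, summed
   over the pairs of opposite faces x_j = L and x_j = - L. *)
Definition cube_flux {R : realType} d (w : 'rV[R]_d -> 'rV[R]_d) (L : R) : R :=
  \sum_(j < d) \int[lebesgue_rV d.-1]_(y in
      [set y : 'rV[R]_d.-1 | forall k, `|y 0 k| <= L])
    (w (rV_insert j L y) 0 j - w (rV_insert j (- L) y) 0 j).

(* In the integration by parts
     \int (grad r . v) p = (boundary term) - \int r div (p v)
   the boundary term is the flux of r p v at infinity. It is required to vanish
   whenever both integrals converge absolutely: the first one does as soon as
   grad r and v are square integrable against p. *)
Definition vanishing_boundary_terms {R : realType} d (p : 'rV[R]_d -> R) : Prop :=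
  forall (r : 'rV[R]_d -> R) (v : 'rV[R]_d -> 'rV[R]_d),
    C1 r -> C1_field v ->
    (\int[lebesgue_rV d]_x (sqnorm (grad r x) * p x)%:E < +oo)%E ->
    (\int[lebesgue_rV d]_x (sqnorm (v x) * p x)%:E < +oo)%E ->
    (lebesgue_rV d).-integrable setT
      (fun x => (r x * divergence (fun y => p y *: v y) x)%:E) ->
    cube_flux (fun x => (r x * p x) *: v x) L @[L --> +oo] --> (0 : R).

Definition prob_density {R : realType} d (p : 'rV[R]_d -> R) : Prop :=
  [/\ measurable_fun setT p, forall x, 0 <= p x &
      (\int[lebesgue_rV d]_x (p x)%:E = 1)%E].

Definition coupling {R : realType} d (p q : 'rV[R]_d -> R)
    (rho : probability ('rV[R]_d * 'rV[R]_d)%type R) : Prop :=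
  (forall A, measurable A ->
     rho (A `*` setT) = \int[lebesgue_rV d]_(x in A) (p x)%:E)%E /\
  (forall A, measurable A ->
     rho (setT `*` A) = \int[lebesgue_rV d]_(x in A) (q x)%:E)%E.

Definition W2 {R : realType} d (p q : 'rV[R]_d -> R) : \bar R :=
  poweR (ereal_inf [set (\int[rho]_z (sqnorm (z.1 - z.2))%:E)%E
                   | rho in coupling p q])
        2^-1.

Definition KL {R : realType} d (P Q : 'rV[R]_d * 'rV[R]_d -> R) : \bar R :=
  (\int[lebesgue_rV d \x lebesgue_rV d]_z (P z * ln (P z / Q z))%:E)%E.

Definition mean_local_velocity {R : realType} d (mu T : R)
    (F : R -> 'rV[R]_d -> 'rV[R]_d) (P : R -> 'rV[R]_d -> R)
    (t : R) (x : 'rV[R]_d) : 'rV[R]_d :=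
  mu *: (F t x - T *: grad (fun y => ln (P t y)) x).

Definition continuity_equation {R : realType} d (P : R -> 'rV[R]_d -> R) (t : R)
    (u : 'rV[R]_d -> 'rV[R]_d) : Prop :=
  forall x, is_derive t 1 (fun s => P s x)
    (- divergence (fun y => P t y *: u y) x).

Definition sigma {R : realType} d (mu T : R)
    (F : R -> 'rV[R]_d -> 'rV[R]_d) (P : R -> 'rV[R]_d -> R) (tau : R) : \bar R :=
  ((mu * T)^-1%:E * \int[lebesgue_rV d]_x
     (sqnorm (mean_local_velocity mu T F P tau x) * P tau x)%:E)%E.

Definition W2_speed2 {R : realType} d (P : R -> 'rV[R]_d -> R) (tau h : R) :
    \bar R :=
  (W2 (P tau) (P (tau + h)%R) ^+ 2 * (h ^+ 2)^-1%:E)%E.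

Definition sigma_ex {R : realType} d (mu T : R) (P : R -> 'rV[R]_d -> R)
    (tau : R) : \bar R :=
  ((mu * T)^-1%:E * lim (W2_speed2 P tau h @[h --> (0%R : R)^']))%E.

Definition sigma_hk {R : realType} d (mu T : R)
    (F : R -> 'rV[R]_d -> 'rV[R]_d) (P : R -> 'rV[R]_d -> R) (tau : R) : \bar R :=
  (sigma mu T F P tau - sigma_ex mu T P tau)%E.

Definition transition {R : realType} d (mu T : R)
    (F : R -> 'rV[R]_d -> 'rV[R]_d) (P : R -> 'rV[R]_d -> R) (tau dt : R)
    (v : 'rV[R]_d -> 'rV[R]_d) (y x : 'rV[R]_d) : R :=
  ((4 * pi * mu * T * dt) `^ (d%:R / 2))^-1 *
  expR (- (sqnorm (y - x - (mu * dt) *: F tau x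
                   - dt *: (v x - mean_local_velocity mu T F P tau x))
           / (4 * mu * T * dt))).

(* The first component of z is x_(tau+dt), the second one x_tau. *)
Definition path_density {R : realType} d (mu T : R)
    (F : R -> 'rV[R]_d -> 'rV[R]_d) (P : R -> 'rV[R]_d -> R) (tau dt : R)
    (v : 'rV[R]_d -> 'rV[R]_d) (z : 'rV[R]_d * 'rV[R]_d) : R :=
  transition mu T F P tau dt v z.1 z.2 * P tau z.2.

(* For v the mean local velocity, the transition density is the Gaussian of mean
   x + mu F_tau(x) dt and covariance 2 mu T dt I. *)
Definition forward_path_density {R : realType} d (mu T : R)
    (F : R -> 'rV[R]_d -> 'rV[R]_d) (P : R -> 'rV[R]_d -> R) (tau dt : R) :
    'rV[R]_d * 'rV[R]_d -> R :=
  path_density mu T F P tau dt (mean_local_velocity mu T F P tau).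

Definition zero_divergence_manifold {R : realType} d (mu T : R)
    (F : R -> 'rV[R]_d -> 'rV[R]_d) (P : R -> 'rV[R]_d -> R) (tau dt : R) :
    set ('rV[R]_d * 'rV[R]_d -> R) :=
  [set path_density mu T F P tau dt v | v in
    [set v | C1_field v /\ forall x, divergence (fun y => P tau y *: v y) x = 0]].

Definition gradient_manifold {R : realType} d (mu T : R)
    (F : R -> 'rV[R]_d -> 'rV[R]_d) (P : R -> 'rV[R]_d -> R) (tau dt : R) :
    set ('rV[R]_d * 'rV[R]_d -> R) :=
  [set path_density mu T F P tau dt (grad r) | r in [set r | C1 r]].

(* Main.v *)
(* The Kullback-Leibler divergence of two Gaussian kernels with the same
   variance is a squared distance of their means, so that, with nu the mean
   local velocity and p the density at time tau,
     4 D(P || P_v) / dt = (mu T)^-1 \int |nu - v|^2 p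
   holds exactly for every dt > 0, even when the right-hand side is infinite.
   Both infima are therefore constant in dt, and are squared distances in
   L^2(p). Since nu and grad phi solve the same continuity equation, w := nu -
   grad phi satisfies div (p w) = 0. By the divergence theorem on large cubes,
   whose flux vanishes by hypothesis, gradients are orthogonal in L^2(p) to such
   fields; by Pythagoras applied to nu - v = grad phi + (w - v) and
   nu - grad r = grad (phi - r) + w, the infima are |grad phi|^2 (attained at
   v = w) and |w|^2 = |nu|^2 - |grad phi|^2 (attained at r = phi). *)
Require Import Defs.
From mathcomp Require Import all_boot all_order all_algebra.
From mathcomp Require Import all_classical all_reals all_analysis.
From mathcomp Require Import measurable_realfun zify ring lra.
Import Order.TTheory GRing.Theory Num.Theory.
Import numFieldNormedType.Exports.
Local Open Scope classical_set_scope.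
Local Open Scope ring_scope.
Set Implicit Arguments.
Unset Strict Implicit.
Unset Printing Implicit Defensive.

(** * Borel measurability on R^d and C^1 functions *)

Section measurability.
Context {R : realType} (d : nat).

Lemma measurable_rV_box (A : 'I_d -> set R) :
  (forall i, measurable (A i)) ->
  measurable [set x : 'rV[R]_d | forall i, A i (x 0 i)].
Proof.
move=> mA.
rewrite (_ : mkset _ = \bigcap_i (rV_coord i @^-1` A i)); last first.
  by apply/seteqP; split => [x /= Ax i _|x Ax i]; [exact: Ax|exact: (Ax i)].
apply: (@fin_bigcap_measurable _ 'rV[R]_d); first exact: finite_finset.
move=> i _.
by rewrite -[X in measurable X]setTI; apply: measurable_rV_coord => //; exact: mA.
Qed.

(** The sigma-algebra is generated by coordinates and the topology by sup-norm balls. The two meet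
    because an open set is a countable union of cubes with rational centre and radius [1/(n+1)]. *)
Lemma open_measurable_rV (U : set 'rV[R]_d) : open U -> measurable U.
Proof.
move=> oU.
pose B (c : 'rV[rat]_d * nat) : set 'rV[R]_d :=
  [set x | forall i, ball (ratr (c.1 0 i) : R) c.2.+1%:R^-1 (x 0 i)].
have mB c : measurable (B c).
  apply: (@measurable_rV_box (fun i => ball (ratr (c.1 0 i) : R) c.2.+1%:R^-1)) => i.
  by apply: open_measurable; apply: ball_open; rewrite invr_gt0.
(* Cubes not contained in [U] are replaced by the empty set, so that the union runs over a whole
   countable type. *)
rewrite (_ : U = \bigcup_c (if asbool (B c `<=` U) then B c else set0)).
  apply: countable_bigcupT_measurable; first exact: countableP.
  by move=> c; case: ifP.
apply/seteqP; split => [x Ux|x [c _]]; last first.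
  by case: asboolP => // BU /BU.
have /nbhs_ballP[e /= e0 eU] : nbhs x U by exact: open_nbhs_nbhs.
(* Half of [e], because [x] is within one radius of the rational centre and every point of the cube
   within another. *)
have [n ne] : exists n, n.+1%:R^-1 < e / 2.
  have [n _ nP] := near_infty_natSinv_lt (PosNum (divr_gt0 e0 (ltr0Sn _ 1))).
  by exists n; exact: (nP n (leqnn n)).
have r0 : 0 < n.+1%:R^-1 :> R by rewrite invr_gt0.
have /= qx i : {q : rat | ball (ratr q : R) n.+1%:R^-1 (x 0 i)}.
  apply: cid.
  have /rat_in_itvoo[q] : x 0 i - n.+1%:R^-1 < x 0 i + n.+1%:R^-1.
    by rewrite ltrD2l gtrN.
  rewrite in_itv /= => /andP[h1 h2]; exists q.
  rewrite /ball /= ltr_distlC; apply/andP; split.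
    by rewrite ltrBlDr.
  by rewrite -ltrBlDr.
exists (\row_i sval (qx i), n) => //.
have Bx : B (\row_i sval (qx i), n) x by move=> i /=; rewrite mxE; exact: (svalP (qx i)).
case: asboolP => // -[] y By; apply: eU; split => // i j.
rewrite (ord1 i); have := ball_triangle (ball_sym (Bx j)) (By j).
apply: le_ball => /=; rewrite (splitr e); apply: lerD; exact: ltW.
Qed.

Lemma continuous_measurable_rV (f : 'rV[R]_d -> R) :
  continuous f -> measurable_fun setT f.
Proof.
move=> /continuousP cf.
apply: (measurability _ (RGenOpens.measurableE R)).
move=> _ [_ [a [b ->] <-]]; rewrite setTI; apply: open_measurable_rV.
by apply: cf; exact: interval_open.
Qed.

End measurability.

Section continuous_operations.
Context {R : realType} (T : topologicalType).
Implicit Types f g : T -> R.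

Lemma continuous_add f g :
  continuous f -> continuous g -> continuous (fun x => f x + g x).
Proof. by move=> cf cg x; apply: continuousD; [exact: cf|exact: cg]. Qed.

Lemma continuous_opp f : continuous f -> continuous (fun x => - f x).
Proof. by move=> cf x; apply: continuousN; exact: cf. Qed.

Lemma continuous_mul f g :
  continuous f -> continuous g -> continuous (fun x => f x * g x).
Proof. by move=> cf cg x; apply: continuousM; [exact: cf|exact: cg]. Qed.

Lemma continuous_inv f :
  (forall x, f x != 0) -> continuous f -> continuous (fun x => (f x)^-1).
Proof. by move=> f0 cf x; apply: continuousV; [exact: f0|exact: cf]. Qed.

End continuous_operations.

Section C1_calculus.
Context {R : realType} (d : nat).
Implicit Types (f g : 'rV[R]_d -> R) (i : 'I_d) (x : 'rV[R]_d).

Lemma partialD f g i x : differentiable f x -> differentiable g x ->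
  partial i (fun y => f y + g y) x = partial i f x + partial i g x.
Proof. by move=> df dg; apply: deriveD; exact: diff_derivable. Qed.

Lemma partialN f i x : differentiable f x ->
  partial i (fun y => - f y) x = - partial i f x.
Proof. by move=> df; apply: deriveN; exact: diff_derivable. Qed.

Lemma partialB f g i x : differentiable f x -> differentiable g x ->
  partial i (fun y => f y - g y) x = partial i f x - partial i g x.
Proof. by move=> df dg; apply: deriveB; exact: diff_derivable. Qed.

Lemma partialM f g i x : differentiable f x -> differentiable g x ->
  partial i (fun y => f y * g y) x = f x * partial i g x + g x * partial i f x.
Proof. by move=> df dg; apply: deriveM; exact: diff_derivable. Qed.

Lemma partial_cst (a : R) i x : partial i (fun=> a) x = 0.
Proof. exact: derive_cst. Qed.

Lemma partial_comp (h : R -> R) f i x :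
  differentiable f x -> derivable h (f x) 1 ->
  partial i (h \o f) x = partial i f x * (h^`()%classic) (f x).
Proof.
move=> df /derivable1_diffP dh.
rewrite /partial deriveE; last exact: differentiable_comp.
by rewrite diff_comp//= deriveE// diff1E.
Qed.

Lemma C1_differentiable f x : C1 f -> differentiable f x.
Proof. by case=> /(_ x). Qed.

Lemma C1_continuous f : C1 f -> continuous f.
Proof. by move=> [df _] x; exact: differentiable_continuous. Qed.

Lemma C1_cst (a : R) : C1 (fun _ : 'rV[R]_d => a).
Proof.
split=> [x|i]; first exact: differentiable_cst.
rewrite (_ : partial i _ = cst 0); first exact: cst_continuous.
by apply/funext => x; exact: partial_cst.
Qed.

Lemma C1D f g : C1 f -> C1 g -> C1 (fun x => f x + g x).
Proof.
move=> [df pf] [dg pg]; split=> [x|i]; first exact: differentiableD.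
rewrite (_ : partial i _ = fun x => partial i f x + partial i g x).
  exact: continuous_add.
by apply/funext => x; exact: partialD.
Qed.

Lemma C1N f : C1 f -> C1 (fun x => - f x).
Proof.
move=> [df pf]; split=> [x|i]; first exact: differentiableN.
rewrite (_ : partial i _ = fun x => - partial i f x).
  exact: continuous_opp.
by apply/funext => x; exact: partialN.
Qed.

Lemma C1B f g : C1 f -> C1 g -> C1 (fun x => f x - g x).
Proof. by move=> cf cg; apply: C1D => //; exact: C1N. Qed.

Lemma C1M f g : C1 f -> C1 g -> C1 (fun x => f x * g x).
Proof.
move=> cf cg; have [[df pf] [dg pg]] := (cf, cg).
split=> [x|i]; first exact: differentiableM.
rewrite (_ : partial i _ =
    fun x => f x * partial i g x + g x * partial i f x).
  by apply: continuous_add; apply: continuous_mul => //; exact: C1_continuous.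
by apply/funext => x; exact: partialM.
Qed.

Lemma C1V f : (forall x, 0 < f x) -> C1 f -> C1 (fun x => (f x)^-1).
Proof.
move=> f0 cf; have [df pf] := cf.
have fn0 x : f x != 0 by rewrite gt_eqF.
split=> [x|i]; first exact: differentiableV.
rewrite (_ : partial i _ = fun x => - (f x * f x)^-1 * partial i f x).
  apply: continuous_mul => //; apply: continuous_opp; apply: continuous_inv.
    by move=> x; rewrite mulf_neq0.
  by apply: continuous_mul; exact: C1_continuous.
apply/funext => x; rewrite /partial deriveV//; last exact: diff_derivable.
Qed.

Lemma partial_ln f i x : 0 < f x -> differentiable f x ->
  partial i (fun y => ln (f y)) x = (f x)^-1 * partial i f x.
Proof.
move=> f0 df; have dl := is_derive1_ln f0.
rewrite (_ : (fun y => ln (f y)) = @ln R \o f)// partial_comp//.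
by rewrite derive1E derive_val mulrC.
Qed.

End C1_calculus.

(** * Integration in slices and the divergence theorem on cubes *)

Section tonelli.
Context {R : realType}.
Local Open Scope ereal_scope.

Lemma measurable_rV_insert d (j : 'I_d.+1) :
  measurable_fun setT
    (fun z : measurableTypeR R * 'rV[R]_d => rV_insert j z.1 z.2).
Proof.
apply: measurable_fun_rV => i.
rewrite (_ : _ \o _ = if unlift j i is Some k then rV_coord k \o snd else fst).
  by case: unlift => [k|] //; apply: measurableT_comp => //;
    exact: measurable_rV_coord.
by apply/funext => z; rewrite /rV_coord/= mxE; case: unlift.
Qed.

Lemma measurable_rV_insertr d (j : 'I_d.+1) (a : R) :
  measurable_fun setT (fun y : 'rV[R]_d => rV_insert j a y).
Proof.
rewrite (_ : (fun _ => _) = (fun z : measurableTypeR R * 'rV[R]_d =>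
  rV_insert j z.1 z.2) \o (fun y => (a, y)))//.
apply: measurableT_comp; first exact: measurable_rV_insert.
exact: measurable_fun_pair.
Qed.

(** This commutation drives the induction in [ge0_integral_rV_insert]: a later coordinate can be
    inserted before or after the first one is prepended. *)
Lemma rV_insert_cons d (j : 'I_d.+1) (a b : R) (y : 'rV[R]_d) :
  rV_insert (lift ord0 j) a (rV_cons (b, y)) = rV_cons (b, rV_insert j a y).
Proof.
apply/rowP => i; rewrite !mxE; case: (unliftP 0%R i) => [k ->|->].
  rewrite /= mxE; case: (unliftP j k) => [l ->|->].
    rewrite (_ : lift 0%R (lift j l) = lift (lift ord0 j) (lift 0%R l)).
      by rewrite liftK mxE liftK.
    by apply/val_inj; rewrite /= /bump /=; lia.
  by rewrite unlift_none.
rewrite /= (_ : 0%R = lift (lift ord0 j) 0%R :> 'I_d.+2).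
  by rewrite liftK mxE unlift_none.
exact/val_inj.
Qed.

(** In positive dimension [lebesgue_rV] is by definition the image under [rV_cons] of a product
    measure, so this is change of variables followed by Tonelli. *)
Lemma ge0_integral_rV_cons d (f : 'rV[R]_d.+1 -> \bar R) :
  measurable_fun setT f -> (forall x, 0 <= f x) ->
  \int[lebesgue_rV d.+1]_x f x =
  \int[lebesgue_measure]_a \int[lebesgue_rV d]_y f (rV_cons (a, y)).
Proof.
move=> mf f0.
rewrite [LHS](_ : _ = \int[pushforward (lebesgue_measure \x lebesgue_rV d)
  (@rV_cons R d)]_x f x)//.
rewrite ge0_integral_pushforward//; last exact: measurable_rV_cons.
rewrite preimage_setT fubini_tonelli1//.
  by apply: measurableT_comp => //; exact: measurable_rV_cons.
by move=> z; exact: f0.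
Qed.

Lemma lebesgue_rV0T : lebesgue_rV 0 [set: 'rV[R]_0] = 1.
Proof. exact: diracT. Qed.

Opaque lebesgue_rV.

(** The measure is built by splitting off the first coordinate. Induction on the dimension brings
    any other coordinate outside: it is split off from the tail, then exchanged with the first
    one. *)
Lemma ge0_integral_rV_insert d (j : 'I_d.+1) (f : 'rV[R]_d.+1 -> \bar R) :
  measurable_fun setT f -> (forall x, 0 <= f x) ->
  \int[lebesgue_rV d.+1]_x f x =
  \int[lebesgue_measure]_a \int[lebesgue_rV d]_y f (rV_insert j a y).
Proof.
elim: d j f => [|d ih] j f mf f0.
  by rewrite (ord1 j) ge0_integral_rV_cons.
case: (unliftP ord0 j) => [k ->|->]; last by rewrite ge0_integral_rV_cons.
rewrite (ge0_integral_rV_cons mf f0).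
have mcons b : measurable_fun setT (fun u : 'rV[R]_d.+1 => f (rV_cons (b, u))).
  apply: measurableT_comp => //.
  by apply: measurableT_comp; [exact: measurable_rV_cons|exact: measurable_fun_pair].
transitivity (\int[lebesgue_measure]_b \int[lebesgue_measure]_a
    \int[lebesgue_rV d]_y f (rV_cons (b, rV_insert k a y))).
  by apply: eq_integral => b _; rewrite (ih k).
(* Pairing the two distinguished coordinates makes the integral over the remaining ones a measurable
   function [G] on the plane, to which Tonelli applies. *)
pose g (z : (measurableTypeR R * measurableTypeR R) * 'rV[R]_d) :=
  f (rV_cons (z.1.1, rV_insert k z.1.2 z.2)).
have mg : measurable_fun setT g.
  apply: measurableT_comp => //.
  apply: (measurableT_comp (@measurable_rV_cons R d.+1)).
  apply: measurable_fun_pair; first exact: measurableT_comp.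
  pose h (z : (measurableTypeR R * measurableTypeR R) * 'rV[R]_d) :=
    (z.1.2, z.2).
  have mh : measurable_fun setT h.
    by apply: measurable_fun_pair => //; exact: measurableT_comp.
  exact: (measurableT_comp (measurable_rV_insert k) mh).
have g0 z : 0 <= g z by exact: f0.
pose G := fubini_F (lebesgue_rV d) g.
have mG : measurable_fun setT G by exact: measurable_fun_fubini_tonelli_F.
have G0 z : 0 <= G z by exact: integral_ge0.
transitivity (\int[lebesgue_measure]_a \int[lebesgue_measure]_b G (b, a)).
  exact: (@fubini_tonelli _ _ _ _ _ lebesgue_measure lebesgue_measure _ mG G0).
apply: eq_integral => a _.
have mfa : measurable_fun setT (fun x => f (rV_insert (lift ord0 k) a x)).
  by apply: measurableT_comp => //; exact: measurable_rV_insertr.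
(* The first coordinate [b] and the tail [y] are glued back together, leaving only [a] split off. *)
rewrite (ge0_integral_rV_cons mfa (fun x => f0 _)).
by apply: eq_integral => b _; apply: eq_integral => y _; rewrite rV_insert_cons.
Qed.

Lemma ge0_integral_rV_insert_swap d (j : 'I_d.+1) (f : 'rV[R]_d.+1 -> \bar R) :
  measurable_fun setT f -> (forall x, 0 <= f x) ->
  \int[lebesgue_rV d.+1]_x f x =
  \int[lebesgue_rV d]_y \int[lebesgue_measure]_a f (rV_insert j a y).
Proof.
move=> mf f0; rewrite (ge0_integral_rV_insert j)//.
apply: (@fubini_tonelli _ _ _ _ _ lebesgue_measure (lebesgue_rV d)
  (fun z => f (rV_insert j z.1 z.2))) => [|z]; last exact: f0.
by apply: measurableT_comp => //; exact: measurable_rV_insert.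
Qed.

End tonelli.

(** Written exactly as the domain of the face integrals in [cube_flux], so that the two agree by
    conversion. *)
Definition cube {R : realType} d (L : R) : set 'rV[R]_d :=
  [set x | forall k, `|x 0 k| <= L].

Arguments cube {R} d L _.

(** * Cubes: slicing, finite measure and flux through faces *)

Section cube.
Context {R : realType}.

Lemma cubeE d (L : R) :
  cube d L = [set x | forall k, `[(- L), L]%classic (x 0 k)].
Proof.
by apply/seteqP; split => x cx k; have := cx k; rewrite /= in_itv/= ler_norml.
Qed.

Lemma measurable_cube d (L : R) : measurable (cube d L).
Proof.
rewrite cubeE.
by apply: (@measurable_rV_box _ _ (fun=> `[(- L), L]%classic)).
Qed.

Lemma compact_cube d (L : R) : compact (cube d L).
Proof.
rewrite cubeE; apply: (@rV_compact R d (fun=> `[(- L), L]%classic)) => i.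
exact: segment_compact.
Qed.

Lemma cube_insert d (L a : R) (j : 'I_d.+1) (y : 'rV[R]_d) :
  cube d.+1 L (rV_insert j a y) <-> `[(- L), L]%classic a /\ cube d L y.
Proof.
rewrite /cube /= in_itv/= -ler_norml; split => [h|[h1 h2] k].
  split; first by have := h j; rewrite mxE unlift_none.
  by move=> k; have := h (lift j k); rewrite mxE liftK.
by rewrite mxE; case: unliftP.
Qed.

Local Open Scope ereal_scope.

Lemma ge0_integral_cube d (j : 'I_d.+1) (L : R) (f : 'rV[R]_d.+1 -> \bar R) :
  measurable_fun setT f -> (forall x, 0 <= f x) ->
  \int[lebesgue_rV d.+1]_(x in cube d.+1 L) f x =
  \int[lebesgue_rV d]_(y in cube d L)
    \int[lebesgue_measure]_(a in `[(- L)%R, L]) f (rV_insert j a y).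
Proof.
move=> mf f0; rewrite integral_mkcond (ge0_integral_rV_insert_swap j).
- rewrite [RHS]integral_mkcond; apply: eq_integral => y _.
  rewrite {2}/patch; case: ifPn => [/set_mem cy|/negP cy].
    rewrite [RHS]integral_mkcond; apply: eq_integral => a _; rewrite /patch.
    congr (if _ then _ else _); apply/idP/idP => [/set_mem|/set_mem ca].
      by rewrite cube_insert => -[ca _]; exact: mem_set.
    by apply/mem_set; rewrite cube_insert.
  rewrite integral0_eq// => a _; rewrite /patch ifF//; apply/negP => /set_mem.
  by rewrite cube_insert => -[_ /mem_set].
- apply/(measurable_restrictT f (measurable_cube L)).
  exact: measurable_funTS.
- by move=> x; rewrite erestrict_ge0.
Qed.

(** Slicing the constant 1 gives the length of a segment times the measure of the cube one dimension
    lower. *)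
Lemma cube_lty d (L : R) : lebesgue_rV d (cube d L) < +oo.
Proof.
have mc n : measurable (cube n L : set 'rV[R]_n) by exact: measurable_cube.
elim: d => [|d ih].
  apply: (@le_lt_trans _ _ (lebesgue_rV 0 [set: 'rV[R]_0])).
    by apply: le_measure; [rewrite inE; exact: mc|rewrite inE; exact: measurableT|exact: subsetT].
  by rewrite lebesgue_rV0T ltry.
rewrite -[X in X < _]mul1e -integral_cst//.
have m1 : measurable_fun setT (cst 1 : 'rV[R]_d.+1 -> \bar R).
  exact: measurable_cst.
rewrite (ge0_integral_cube ord0 L m1)//.
under eq_integral do rewrite integral_cst// mul1e.
  rewrite [X in X < _](integral_cst (lebesgue_rV d) (mc d)).
  apply: lte_mul_pinfty => //; first exact: (measure_ge0 (@lebesgue_measure R)).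
  suff : (@lebesgue_measure R) `[(- L)%R, L]%classic \is a fin_num by [].
  by rewrite lebesgue_measure_itv; case: ifP.
exact: mc.
Qed.

Lemma continuous_integrable_cube d (L : R) (f : 'rV[R]_d -> R) :
  continuous f -> (lebesgue_rV d).-integrable (cube d L) (EFin \o f).
Proof.
move=> cf; apply: measurable_bounded_integrable.
- exact: measurable_cube.
- exact: cube_lty.
- by apply: measurable_funTS; exact: continuous_measurable_rV.
- have : compact (f @` cube d L).
    apply: continuous_compact; last exact: compact_cube.
    exact: continuous_subspaceT.
  move=> /compact_bounded[M [_ mrt]].
  by exists M; split; rewrite ?num_real // => ? ? ? ?; exact: mrt.
Qed.

(** Signed version of [ge0_integral_cube]: positive and negative parts are sliced separately, and
    both are integrable because a continuous function is bounded on a compact cube. *)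
Lemma integral_cube d (j : 'I_d.+1) (L : R) (f : 'rV[R]_d.+1 -> R) :
  continuous f ->
  \int[lebesgue_rV d.+1]_(x in cube d.+1 L) (f x)%:E =
  \int[lebesgue_rV d]_(y in cube d L)
    \int[lebesgue_measure]_(a in `[(- L)%R, L]) (f (rV_insert j a y))%:E.
Proof.
move=> cf.
have mf : measurable_fun setT (EFin \o f).
  by apply/measurable_EFinP; exact: continuous_measurable_rV.
have fi := continuous_integrable_cube L cf.
have mpos := measurable_funepos mf.
have mneg := measurable_funeneg mf.
(* The slice integrals of each part must themselves be integrable before their difference can be
   taken under the outer integral. *)
have key (g : 'rV[R]_d.+1 -> \bar R) : measurable_fun setT g ->
    (forall x, 0 <= g x) -> (lebesgue_rV d.+1).-integrable (cube d.+1 L) g ->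
    (lebesgue_rV d).-integrable (cube d L) (fun y =>
      \int[lebesgue_measure]_(a in `[(- L)%R, L]) g (rV_insert j a y)).
  move=> mg g0 ig; apply/integrableP; split.
    apply: measurable_funTS.
    (* Extending by zero outside the slab turns the inner integral into one over the whole line,
       whose measurability Tonelli provides. *)
    pose h (z : measurableTypeR R * 'rV[R]_d) :=
      (fun z : measurableTypeR R * 'rV[R]_d => g (rV_insert j z.1 z.2))
      \_ (`[(- L)%R, L]%classic `*` setT) z.
    have mh : measurable_fun setT h.
      have mE : measurable (`[(- L)%R, L]%classic `*` [set: 'rV[R]_d]).
        exact: measurableX.
      apply/(measurable_restrictT _ mE).
      apply: measurable_funTS; apply: measurableT_comp => //.
      exact: measurable_rV_insert.
    have h0 z : 0 <= h z by apply: erestrict_ge0.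
    have := @measurable_fun_fubini_tonelli_G _ _ _ _ _ lebesgue_measure h mh h0.
    congr measurable_fun; apply/funext => y; rewrite /fubini_G [RHS]integral_mkcond.
    apply: eq_integral => a _; rewrite /h /patch.
    by rewrite in_setX in_setT andbT.
  rewrite (eq_integral (fun y =>
    \int[lebesgue_measure]_(a in `[(- L)%R, L]) g (rV_insert j a y))); last first.
    by move=> y _; rewrite gee0_abs//; apply: integral_ge0.
  rewrite -ge0_integral_cube//; apply: integrable_lty => //; exact: measurable_cube.
rewrite integralE (ge0_integral_cube j L mpos)// (ge0_integral_cube j L mneg)//.
rewrite -integralB//=; first last.
- by apply: key => //; apply: integrable_funeneg => //; exact: measurable_cube.
- by apply: key => //; apply: integrable_funepos => //; exact: measurable_cube.
- exact: measurable_cube.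
apply: eq_integral => y _; rewrite [RHS]integralE.
by congr (_ - _); apply: eq_integral => a _; rewrite ?funeposE ?funenegE.
Qed.

Lemma rV_insert_shift d (j : 'I_d.+1) (h a : R) (y : 'rV[R]_d) :
  (rV_insert j (h + a) y = h *: delta_mx 0 j + rV_insert j a y)%R.
Proof.
apply/rowP => i; rewrite !mxE /=; case: unliftP => [k|] ->.
  by rewrite eq_sym (negbTE (neq_lift _ _)) mulr0 add0r.
by rewrite eqxx mulr1.
Qed.

(** By [rV_insert_shift], the one-variable difference quotient is the very quotient that defines the
    partial derivative. *)
Lemma is_derive_rV_insert d (j : 'I_d.+1) (f : 'rV[R]_d.+1 -> R) (a : R)
    (y : 'rV[R]_d) :
  differentiable f (rV_insert j a y) ->
  is_derive a (1%R : R) (fun b => f (rV_insert j b y)) (partial j f (rV_insert j a y)).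
Proof.
move=> /diff_derivable df.
have e : (fun h : R => h^-1 *: (((fun b => f (rV_insert j b y)) \o shift a)
      (h *: (1 : R)) - f (rV_insert j a y)))%R =
    (fun h => h^-1 *: ((f \o shift (rV_insert j a y)) (h *: delta_mx 0 j) -
      f (rV_insert j a y)))%R.
  apply/funext => h /=; congr (_ *: (f _ - _))%R.
  by rewrite -rV_insert_shift; congr (rV_insert j (_ + a)%R y); exact: mulr1.
split; first by rewrite /derivable e; exact: df.
by rewrite /derive e.
Qed.

Lemma continuous_rV_insert d (j : 'I_d.+1) (y : 'rV[R]_d) :
  continuous (fun a : R => rV_insert j a y).
Proof.
move=> a.
have -> : (fun b : R => rV_insert j b y) =
    (fun b : R => b *: delta_mx 0 j + rV_insert j 0 y)%R.
  by apply/funext => b; rewrite -rV_insert_shift addr0.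
apply: cvgD; last exact: cvg_cst.
by apply: cvgZl; exact: cvg_id.
Qed.

Lemma continuous_rV_insertr d (j : 'I_d.+1) (a : R) :
  continuous (fun y : 'rV[R]_d => rV_insert j a y).
Proof.
(* Insertion does not increase sup-norm distances, so the same radius [e] works. *)
move=> y A /nbhs_ballP[e /= e0 eA]; apply/nbhs_ballP; exists e => //= z [_ yz].
apply: eA; split => // i k; rewrite !mxE; case: unliftP => [l|] _; last exact: ballxx.
exact: yz.
Qed.

Lemma FTC_rV_insert d (j : 'I_d.+1) (L : R) (f : 'rV[R]_d.+1 -> R) (y : 'rV[R]_d) :
  (0 < L)%R -> C1 f ->
  \int[lebesgue_measure]_(a in `[(- L)%R, L]) (partial j f (rV_insert j a y))%:E =
  (f (rV_insert j L y) - f (rV_insert j (- L)%R y))%:E.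
Proof.
move=> L0 [df cpf].
have cf (g : 'rV[R]_d.+1 -> R) : continuous g ->
    continuous (fun a => g (rV_insert j a y)).
  by move=> cg a; apply: continuous_comp; [exact: continuous_rV_insert|exact: cg].
have fder a := is_derive_rV_insert (df (rV_insert j a y)).
have cg : continuous (fun a => f (rV_insert j a y)).
  by apply: cf; apply: C1_continuous.
rewrite (@continuous_FTC2 _ _ (fun a => f (rV_insert j a y))) ?EFinB//.
- lra.
- by apply: continuous_subspaceT; apply: cf; exact: cpf.
- split => [x _| |]; first exact: ex_derive.
    exact/cvg_at_right_filter/cg.
  exact/cvg_at_left_filter/cg.
- by move=> x _; rewrite derive1E derive_val.
Qed.

(** Each term of the divergence is sliced along its own coordinate, where the fundamental theorem of
    calculus leaves the difference of the values on two opposite faces. *)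
Theorem divergence_theorem_cube d (L : R) (w : 'rV[R]_d.+1 -> 'rV[R]_d.+1) :
  (0 < L)%R -> C1_field w ->
  \int[lebesgue_rV d.+1]_(x in cube d.+1 L) (divergence w x)%:E =
  (cube_flux w L)%:E.
Proof.
move=> L0 cw; rewrite /divergence /cube_flux.
have cp j : continuous (partial j (fun x => w x 0%R j)) by have [_] := cw j; exact.
under eq_integral do rewrite -sumEFin.
rewrite integral_sum//; last 2 first.
- exact: measurable_cube.
- by move=> j; apply: continuous_integrable_cube.
rewrite -sumEFin; apply: eq_bigr => j _.
rewrite (integral_cube j)//.
under eq_integral do rewrite FTC_rV_insert//.
(* [cube_flux] is a real integral; it represents the extended one because the integrand is
   continuous on a compact face. *)
rewrite /Rintegral fineK//; apply: integrable_fin_num; first exact: measurable_cube.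
apply: continuous_integrable_cube.
have cw' a : continuous (fun y => w (rV_insert j a y) 0%R j).
  move=> y; apply: (@continuous_comp _ _ _ (rV_insert j a) (fun x => w x 0%R j)).
    exact: continuous_rV_insertr.
  exact: (C1_continuous (cw j)).
apply: continuous_add; first exact: cw'.
by apply: continuous_opp; exact: cw'.
Qed.

End cube.

(** * Gaussian densities *)

Definition dot {R : realType} d (u v : 'rV[R]_d) : R := \sum_i u 0 i * v 0 i.

(** The parameter [s] is twice the variance of each coordinate; it will be [4 mu T dt]. *)
Definition gaussian {R : realType} d (s : R) (m y : 'rV[R]_d) : R :=
  ((pi * s) `^ (d%:R / 2))^-1 * expR (- (sqnorm (y - m) / s)).

Section gaussian.
Context {R : realType} (d : nat).
Implicit Types (m c y : 'rV[R]_d) (s t : R).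

Lemma sqnormD c y : sqnorm (c + y) = sqnorm c + 2 * dot c y + sqnorm y.
Proof.
rewrite /sqnorm /dot mulr_sumr -!big_split; apply: eq_bigr => i _.
rewrite !mxE /=; ring.
Qed.

Lemma sqnormZ s y : sqnorm (s *: y) = s ^+ 2 * sqnorm y.
Proof.
by rewrite /sqnorm mulr_sumr; apply: eq_bigr => i _; rewrite !mxE exprMn.
Qed.

Lemma sqnorm_ge0 y : 0 <= sqnorm y.
Proof. by apply: sumr_ge0 => i _; exact: sqr_ge0. Qed.

Lemma measurable_fun_sqnorm d' (T : measurableType d') (f : T -> 'rV[R]_d) :
  (forall i, measurable_fun setT (fun z => f z 0 i)) ->
  measurable_fun setT (fun z => sqnorm (f z)).
Proof. by move=> mf; apply: measurable_sum => i; exact: measurable_funX. Qed.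

Lemma measurable_fun_dot d' (T : measurableType d') (f g : T -> 'rV[R]_d) :
  (forall i, measurable_fun setT (fun z => f z 0 i)) ->
  (forall i, measurable_fun setT (fun z => g z 0 i)) ->
  measurable_fun setT (fun z => dot (f z) (g z)).
Proof. by move=> mf mg; apply: measurable_sum => i; exact: measurable_funM. Qed.

Lemma measurable_gaussian_comp d' (T : measurableType d') s
    (f g : T -> 'rV[R]_d) :
  (forall i, measurable_fun setT (fun z => f z 0 i)) ->
  (forall i, measurable_fun setT (fun z => g z 0 i)) ->
  measurable_fun setT (fun z => gaussian s (f z) (g z)).
Proof.
move=> mf mg; apply: measurable_funM => //; apply: measurableT_comp => //.
apply: measurableT_comp => //; apply: measurable_funM => //.
apply: measurable_fun_sqnorm => i.
rewrite (_ : (fun _ => _) = fun z => g z 0 i - f z 0 i); last first.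
  by apply/funext => y; rewrite !mxE.
exact: measurable_funB.
Qed.

Lemma measurable_gaussian s m : measurable_fun setT (gaussian s m).
Proof.
by apply: measurable_gaussian_comp => // i; exact: measurable_rV_coord.
Qed.

Lemma gaussian_gt0 s m y : 0 < s -> 0 < gaussian s m y.
Proof.
by move=> s0; rewrite mulr_gt0 ?expR_gt0// invr_gt0 powR_gt0// mulr_gt0// pi_gt0.
Qed.

(** Completing the square: an exponential of a linear function shifts the mean. General [t] serves
    the first moment, and [t = 1] the logarithm of a ratio of Gaussians. *)
Lemma gaussian_tilt s t m c y : s != 0 ->
  gaussian s m y * expR (t * (2 * dot c (y - m) / s)) =
  gaussian s (m + t *: c) y * expR (t ^+ 2 * (sqnorm c / s)).
Proof.
move=> s0; rewrite /gaussian -!mulrA -!expRD; congr (_ * expR _).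
have -> : y - (m + t *: c) = (- t) *: c + (y - m).
  by apply/rowP => i; rewrite !mxE; ring.
rewrite (sqnormD (- t *: c)) sqnormZ.
have -> : dot ((- t) *: c) (y - m) = - t * dot c (y - m).
  by rewrite /dot mulr_sumr; apply: eq_bigr => i _; rewrite !mxE; ring.
by field.
Qed.

End gaussian.

Section gaussian_integral.
Context {R : realType}.
Local Open Scope ereal_scope.

(** The first coordinate splits off as a normal law of variance [s / 2], so the total mass can be
    computed by induction. *)
Lemma gaussian_cons d (s : R) (m : 'rV[R]_d.+1) (a : R) (y : 'rV[R]_d) :
  (0 < s)%R ->
  gaussian s m (rV_cons (a, y)) =
  (normal_pdf (m ord0 ord0) (Num.sqrt (s / 2)) a *
   gaussian s (\row_j m ord0 (lift ord0 j)) y)%R.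
Proof.
move=> s0.
have q0 : Num.sqrt (s / 2) != 0%R.
  by rewrite gt_eqF// sqrtr_gt0 divr_gt0.
have pis : (0 < pi * s)%R by rewrite mulr_gt0// pi_gt0.
rewrite normal_pdfE// /gaussian /normal_peak /normal_fun sqr_sqrtr; last first.
  by rewrite ltW// divr_gt0.
have -> : (s / 2 * pi *+ 2 = pi * s)%R by rewrite -mulr_natr; field.
have -> : (s / 2 *+ 2 = s)%R by rewrite -mulr_natr; field.
have -> : (d.+1%:R / 2 = 2^-1 + d%:R / 2 :> R)%R by rewrite -natr1; field.
rewrite powRD; last by rewrite gt_eqF// implybT.
rewrite powR12_sqrt ?ltW// invfM.
have -> : (sqnorm (rV_cons (a, y) - m) =
    (a - m ord0 ord0) ^+ 2 + sqnorm (y - \row_j m ord0 (lift ord0 j)))%R.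
  rewrite /sqnorm big_ord_recl; congr (_ + _)%R.
    by rewrite !mxE unlift_none.
  by apply: eq_bigr => i _; rewrite !mxE liftK.
set A := (_ ^+ 2)%R; set B := sqnorm _.
have -> : (- ((A + B) / s) = - A / s - B / s)%R by ring.
rewrite expRD; ring.
Qed.

Lemma integral_gaussian d (s : R) (m : 'rV[R]_d) : (0 < s)%R ->
  \int[lebesgue_rV d]_y (gaussian s m y)%:E = 1.
Proof.
move=> s0; elim: d m => [|d ih] m.
  (* In dimension 0 the density is 1 and the measure is a unit mass. *)
  rewrite (eq_integral (cst 1)) => [|y _].
    by rewrite integral_cst// mul1e; exact: lebesgue_rV0T.
  rewrite /gaussian /sqnorm big_ord0 !mul0r oppr0 expR0 powRr0.
  by rewrite invr1 mulr1.
have g0 k (m' y : 'rV[R]_k) : 0 <= (gaussian s m' y)%:E.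
  by rewrite lee_fin ltW// gaussian_gt0.
rewrite ge0_integral_rV_cons//; last first.
  by apply/measurable_EFinP; exact: measurable_gaussian.
under eq_integral => a _.
  under eq_integral do rewrite gaussian_cons// EFinM.
  rewrite ge0_integralZl//; last 2 first.
  - by apply/measurable_EFinP; exact: measurable_gaussian.
  - by rewrite lee_fin normal_pdf_ge0.
  rewrite ih mule1.
  over.
exact: integral_normal_pdf.
Qed.

Lemma integrable_gaussian d (s : R) (m : 'rV[R]_d) : (0 < s)%R ->
  (lebesgue_rV d).-integrable setT (EFin \o gaussian s m).
Proof.
move=> s0; apply/integrableP; split.
  by apply/measurable_EFinP; exact: measurable_gaussian.
under eq_integral do rewrite gee0_abs ?lee_fin ?(ltW (gaussian_gt0 _ _ s0))//.
by rewrite integral_gaussian// ltry.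
Qed.

End gaussian_integral.

Opaque gaussian sqnorm dot.

(** The right-hand side is [1 + O(t^2)], so a nonzero slope [M] violates the bound for small [t] of
    the sign of [M]; the choice is [t = e * M]. *)
Lemma eq0_of_expR_bound {R : realType} (k M : R) : 0 <= k ->
  (forall t, 1 + t * M <= expR (t ^+ 2 * k)) -> M = 0.
Proof.
move=> k0 h; apply/eqP/negPn/negP => M0.
have M2 : 0 < M ^+ 2 by rewrite exprn_even_gt0.
(* Small enough that [e * k] and [e * M ^+ 2] are both at most [1/2], hence [u <= 1/4]. *)
pose e := (2 * (1 + k) * (1 + M ^+ 2))^-1.
have e0 : 0 < e by rewrite invr_gt0 !mulr_gt0//; lra.
have eE : e * (2 * (1 + k) * (1 + M ^+ 2)) = 1.
  by rewrite mulVf// !mulf_neq0//; lra.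
have ek : e * k <= 1 / 2.
  have := mulr_ge0 (mulr_ge0 (ltW e0) k0) (ltW M2).
  have := mulr_ge0 (ltW e0) (ltW M2).
  by nra.
pose u := (e * M) ^+ 2 * k.
have u1 : u <= 1 / 4.
  have eM : e * M ^+ 2 <= 1 / 2.
    have := mulr_ge0 (mulr_ge0 (ltW e0) k0) (ltW M2).
    have := mulr_ge0 (ltW e0) k0.
    by nra.
  have -> : u = (e * k) * (e * M ^+ 2) by rewrite /u; ring.
  have : 0 <= e * k by rewrite mulr_ge0// ltW.
  have : 0 <= e * M ^+ 2 by rewrite mulr_ge0// ltW.
  by nra.
have h1 := h (e * M); rewrite -/u in h1.
have h2 := expR_ge1Dx (- u).
have h3 : expR u * expR (- u) = 1 by rewrite -expRD subrr expR0.
(* Multiplying the two bounds gives [(1 + e M^2) (1 - u) <= 1]. Since [u = e M^2 * (e k)], division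
   by [e M^2] yields [1 - u <= e k], that is, [3/4 <= 1/2]. *)
have h4 : (1 + e * M * M) * (1 - u) <= expR u * expR (- u).
  apply: ler_pM; [|lra|exact: h1|exact: h2].
  by rewrite addr_ge0// -mulrA -expr2 mulr_ge0// ltW.
rewrite h3 in h4.
have h5 : e * M ^+ 2 * (1 - u) <= e * M ^+ 2 * (e * k).
  have -> : e * M ^+ 2 * (e * k) = u by rewrite /u; ring.
  by move: h4; rewrite -mulrA -expr2; lra.
have : 1 - u <= e * k by rewrite -(ler_pM2l (mulr_gt0 e0 M2)).
by lra.
Qed.

(** * First moment of a Gaussian and relative entropy of two shifted copies *)

Section gaussian_moment.
Context {R : realType} (d : nat) (s : R) (m c : 'rV[R]_d).
Hypothesis s0 : 0 < s.
Local Notation G := (gaussian s m).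
Local Notation k := (sqnorm c / s).
Let l (y : 'rV[R]_d) : R := 2 * dot c (y - m) / s.

Let k0 : 0 <= k. Proof. by rewrite divr_ge0 ?sqnorm_ge0// ltW. Qed.

Let G0 (m' y : 'rV[R]_d) : 0 < gaussian s m' y. Proof. exact: gaussian_gt0. Qed.

Let tilt t y :
  G y * expR (t * l y) = gaussian s (m + t *: c) y * expR (t ^+ 2 * k).
Proof. by apply: gaussian_tilt; rewrite gt_eqF. Qed.

Let measurable_l : measurable_fun setT l.
Proof.
apply: measurable_funM => //; apply: measurable_funM => //.
apply: (@measurable_fun_dot R d _ 'rV[R]_d (fun=> c) (fun y => y - m)) => i.
  exact: measurable_cst.
rewrite (_ : (fun _ => _) = fun y : 'rV[R]_d => y 0 i - m 0 i); last first.
  by apply/funext => y; rewrite !mxE.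
by apply: measurable_funB => //; exact: measurable_rV_coord.
Qed.

(** Domination by [|l| <= exp l + exp (- l)]: tilting with [t = 1] and [t = -1] turns the bound into
    [exp k] times the sum of two shifted Gaussians. *)
Lemma integrable_gaussian_moment :
  (lebesgue_rV d).-integrable setT (fun y => (G y * (2 * dot c (y - m) / s))%:E).
Proof.
pose g y := ((expR k)%:E * ((gaussian s (m + (1 *: c)%R)%R y)%:E +
  (gaussian s (m + ((-1) *: c)%R)%R y)%:E))%E.
have ig : (lebesgue_rV d).-integrable setT g.
  apply: integrableZl => //; apply: integrableD => //;
  exact: integrable_gaussian.
apply: le_integrable ig => //.
  apply/measurable_EFinP; apply: measurable_funM => //.
  exact: measurable_gaussian.
move=> y _; rewrite /g -EFinD -EFinM !abse_EFin lee_fin.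
rewrite [leRHS]ger0_norm; last first.
  by rewrite mulr_ge0 ?expR_ge0// addr_ge0// ltW.
have -> : expR k * (gaussian s (m + 1 *: c) y + gaussian s (m + -1 *: c) y) =
    G y * (expR (1 * l y) + expR (- 1 * l y)).
  by rewrite [RHS]mulrDr (tilt 1 y) (tilt (-1) y) sqrrN expr1n mul1r; ring.
rewrite normrM (gtr0_norm (G0 _ _)) ler_pM2l// -/(l y).
have h1 := expR_ge1Dx (1 * l y); have h2 := expR_ge1Dx (- 1 * l y).
have := expR_gt0 (1 * l y); have := expR_gt0 (- 1 * l y).
by rewrite ler_norml => ? ?; apply/andP; split; lra.
Qed.

(* Integrating 1 + t l <= exp (t l) for all t bounds the first moment of l by
   the tilted Gaussians, which are shifted Gaussians up to a constant. *)
Lemma integral_gaussian_moment :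
  (\int[lebesgue_rV d]_y (G y * (2 * dot c (y - m) / s))%:E = 0)%E.
Proof.
have il := integrable_gaussian_moment.
have iG := integrable_gaussian m s0.
rewrite -(fineK (integrable_fin_num _ il))//; congr EFin.
apply: (eq0_of_expR_bound k0) => t; rewrite -lee_fin EFinD EFinM fineK; last first.
  exact: integrable_fin_num.
rewrite -(integral_gaussian m s0) -integralZl// -integralD//; last first.
  exact: integrableZl.
rewrite -[leRHS]mule1 -(integral_gaussian (m + t *: c) s0) -integralZl//; last first.
  exact: integrable_gaussian.
apply: le_integral => //.
- by apply: integrableD => //; exact: integrableZl.
- by apply: integrableZl => //; exact: integrable_gaussian.
move=> y _; rewrite -!EFinM -EFinD lee_fin.
rewrite [leRHS]mulrC -(tilt t y) -/(l y).
have -> : G y + t * (G y * l y) = G y * (1 + t * l y) by ring.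
by rewrite ler_pM2l// expR_ge1Dx.
Qed.

Lemma ln_gaussian_ratio y :
  ln (G y / gaussian s (m + c) y) = k - 2 * dot c (y - m) / s.
Proof.
have := tilt 1 y; rewrite mul1r scale1r expr1n mul1r => h.
have -> : G y / gaussian s (m + c) y = expR (k - l y).
  rewrite expRD expRN; apply/eqP; rewrite eqr_div; last 2 first.
  - by rewrite gt_eqF.
  - by rewrite gt_eqF// expR_gt0.
  by rewrite h mulrC.
by rewrite expRK.
Qed.

(** The log-ratio is [k] minus a centred linear function, whose integral vanishes. The two added
    densities have mass one and cancel; they keep the integrand nonnegative for later use with
    Tonelli. *)
Lemma gaussian_KL :
  (\int[lebesgue_rV d]_y (G y * ln (G y / gaussian s (m + c) y)
     - G y + gaussian s (m + c) y)%:E = k%:E)%E.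
Proof.
have il := integrable_gaussian_moment.
have iG := integrable_gaussian m s0.
have iH := integrable_gaussian (m + c) s0.
under eq_integral => y _.
  rewrite ln_gaussian_ratio (_ : _ + _ =
    (k - 1) * G y - G y * (2 * dot c (y - m) / s) + gaussian s (m + c) y);
    last by ring.
  rewrite EFinD EFinB EFinM.
  over.
rewrite integralD//; last first.
  by apply: integrableB => //; exact: integrableZl.
rewrite integralB//; last exact: integrableZl.
rewrite integralZl// integral_gaussian_moment !integral_gaussian//.
by rewrite mule1 sube0 -EFinD subrK.
Qed.

End gaussian_moment.

(** * The relative entropy of two Gaussian kernels *)

(** This is [1 + x <= exp x] at [x = ln (b / a)], multiplied by [a]. *)
Lemma xlnx_divergence_ge0 {R : realType} (a b : R) : 0 < a -> 0 < b ->
  0 <= a * ln (a / b) - a + b.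
Proof.
move=> a0 b0; have ba : 0 < b / a by rewrite divr_gt0.
have := expR_ge1Dx (ln (b / a)); rewrite lnK ?posrE// => h.
have -> : ln (a / b) = - ln (b / a) by rewrite -lnV ?posrE// invf_div.
have -> : a * - ln (b / a) - a + b = a * (b / a - (1 + ln (b / a))).
  by field; rewrite gt_eqF.
by apply: mulr_ge0; [exact: ltW|rewrite subr_ge0].
Qed.

Lemma measurable_divergence {R : realType} d (T : measurableType d)
    (P Q : T -> R) :
  measurable_fun setT P -> measurable_fun setT Q ->
  (forall z, 0 < P z) -> (forall z, 0 < Q z) ->
  measurable_fun setT (fun z => P z * ln (P z / Q z)).
Proof.
move=> mP mQ P0 Q0.
rewrite (_ : (fun _ => _) = fun z => P z * (ln (P z) - ln (Q z))).
  apply: measurable_funM => //.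
  by apply: measurable_funB; apply: measurableT_comp => //; exact: measurable_ln.
by apply/funext => z; rewrite ln_div ?posrE.
Qed.

(* Adding Q - P, whose integral vanishes, makes the integrand nonnegative: Tonelli's
   theorem then applies even when the divergence is infinite. *)
Lemma integral_divergence {R : realType} d (T : measurableType d)
    (mu : {measure set T -> \bar R}) (P Q : T -> R) :
  measurable_fun setT P -> measurable_fun setT Q ->
  (forall z, 0 < P z) -> (forall z, 0 < Q z) ->
  (\int[mu]_z (P z)%:E = 1)%E -> (\int[mu]_z (Q z)%:E = 1)%E ->
  (\int[mu]_z (P z * ln (P z / Q z))%:E =
   \int[mu]_z (P z * ln (P z / Q z) - P z + Q z)%:E)%E.
Proof.
move=> mP mQ P0 Q0 iP iQ.
pose f z := P z * ln (P z / Q z).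
pose g z := f z - P z + Q z.
have g0 z : 0 <= g z by exact: xlnx_divergence_ge0.
have mf : measurable_fun setT f by exact: measurable_divergence.
have mg : measurable_fun setT g.
  by apply: measurable_funD => //; exact: measurable_funB.
have mEf : measurable_fun setT (EFin \o f) by exact/measurable_EFinP.
have mpos := measurable_funepos mEf.
have mneg := measurable_funeneg mEf.
(* From [g >= 0] follows [- f <= Q - P <= Q], so the negative part of [f] is dominated by a
   probability density. *)
have neg_fin : (\int[mu]_z (EFin \o f)^\- z \is a fin_num)%E.
  rewrite ge0_fin_numE; last exact: integral_ge0.
  apply: (@le_lt_trans _ _ (\int[mu]_z (Q z)%:E)%E); last by rewrite iQ ltry.
  apply: ge0_le_integral => //.
  - by apply/measurable_EFinP.
  - move=> z _; rewrite funenegE /= -EFin_max lee_fin ge_max.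
    apply/andP; split; last exact: ltW.
    by have := g0 z; rewrite /g; have := P0 z; lra.
(* The pointwise identity [g + P + f^- = f^+ + Q] has only nonnegative terms, so it integrates
   without any finiteness assumption. *)
have key : (\int[mu]_z (g z)%:E + 1 + \int[mu]_z (EFin \o f)^\- z =
    \int[mu]_z (EFin \o f)^\+ z + 1)%E.
  rewrite -{1}iP -iQ -!ge0_integralD//.
  - apply: eq_integral => z _; rewrite funeposE funenegE /=.
    rewrite -!EFin_max -!EFinD; congr EFin; rewrite /g.
    case: (leP (f z) 0) => fz; case: (leP (- f z) 0) => fz'; lra.
  - by move=> z _; rewrite lee_fin ltW.
  - exact/measurable_EFinP.
  - by move=> z _; rewrite -EFinD lee_fin addr_ge0// ltW.
  - by under eq_fun do rewrite -EFinD; apply/measurable_EFinP; exact: measurable_funD.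
  - by move=> z _; rewrite lee_fin.
  - exact/measurable_EFinP.
  - by move=> z _; rewrite lee_fin ltW.
  - exact/measurable_EFinP.
rewrite integralE -/f; move: key; rewrite -(fineK neg_fin).
have -> : (\int[mu]_z (P z * ln (P z / Q z) - P z + Q z)%:E = \int[mu]_z (g z)%:E)%E by [].
(* Only the negative part is known to have finite integral; the cases include the value [+oo] for
   the other two. *)
move: (fine _) (\int[mu]_z (g z)%:E)%E (\int[mu]_z (EFin \o f)^\+ z)%E => n.
move=> [a| |] [b| |]//=; rewrite -?EFinD => -[h]; congr EFin; lra.
Qed.

(** The common factor [p] cancels in the logarithm. Given the starting point, what remains is
    [gaussian_KL] for two Gaussians whose means differ by [c]. *)
Lemma KL_gaussian_kernel {R : realType} d (s : R) (p : 'rV[R]_d -> R)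
    (m c : 'rV[R]_d -> 'rV[R]_d) :
  0 < s -> measurable_fun setT p -> (forall x, 0 < p x) ->
  (\int[lebesgue_rV d]_x (p x)%:E = 1)%E ->
  (forall i, measurable_fun setT (fun x => m x 0 i)) ->
  (forall i, measurable_fun setT (fun x => c x 0 i)) ->
  (KL (fun z => gaussian s (m z.2) z.1 * p z.2)%R
      (fun z => gaussian s (m z.2 + c z.2) z.1 * p z.2)%R =
   \int[lebesgue_rV d]_x (sqnorm (c x) / s * p x)%:E)%E.
Proof.
move=> s0 mp p0 ip mm mc.
pose kernel (n : 'rV[R]_d -> 'rV[R]_d) (z : 'rV[R]_d * 'rV[R]_d) :=
  gaussian s (n z.2) z.1 * p z.2.
have mk (n : 'rV[R]_d -> 'rV[R]_d) : (forall i, measurable_fun setT (fun x => n x 0 i)) ->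
    measurable_fun setT (kernel n).
  move=> mn; apply: measurable_funM; last exact: measurableT_comp.
  apply: measurable_gaussian_comp => i.
    exact: (measurableT_comp (mn i)).
  exact: (measurableT_comp (@measurable_rV_coord R d i)).
have k0 n z : 0 < kernel n z by rewrite mulr_gt0// gaussian_gt0.
have ik (n : 'rV[R]_d -> 'rV[R]_d) : (forall i, measurable_fun setT (fun x => n x 0 i)) ->
    (\int[lebesgue_rV d \x lebesgue_rV d]_z (kernel n z)%:E = 1)%E.
  move=> mn; rewrite fubini_tonelli2//=; last 2 first.
  - by apply/measurable_EFinP; apply: mk.
  - by move=> z; rewrite lee_fin ltW.
  rewrite -ip; apply: eq_integral => x _; rewrite /fubini_G /kernel /=.
  under eq_integral do rewrite EFinM muleC.
  rewrite ge0_integralZl//; last 3 first.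
  - by apply/measurable_EFinP; exact: measurable_gaussian.
  - by move=> y _; rewrite lee_fin ltW// gaussian_gt0.
  - by rewrite lee_fin ltW.
  by rewrite integral_gaussian// mule1.
have mmc i : measurable_fun setT (fun x => (m x + c x) 0 i).
  by under eq_fun do rewrite mxE; exact: measurable_funD.
rewrite /KL (@integral_divergence _ _ _ _ (kernel m) (kernel (fun x => m x + c x)))//;
  [|exact: mk|exact: mk|exact: ik|exact: ik].
(* The arrival point, first component of the pair, is integrated first, with the starting point
   fixed. *)
rewrite fubini_tonelli2//=; last 2 first.
- apply/measurable_EFinP; apply: measurable_funD; last exact: mk.
  apply: measurable_funB; last exact: mk.
  by apply: measurable_divergence => //; exact: mk.
- by move=> z; rewrite lee_fin xlnx_divergence_ge0.
apply: eq_integral => x _; rewrite /fubini_G /kernel /=.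
rewrite (eq_integral (fun y => ((p x)%:E * (gaussian s (m x) y *
   ln (gaussian s (m x) y / gaussian s (m x + c x) y) - gaussian s (m x) y
   + gaussian s (m x + c x) y)%:E)%E)); last first.
  move=> y _; rewrite -EFinM; congr EFin.
  rewrite -mulf_div divff ?gt_eqF// mulr1; ring.
rewrite ge0_integralZl//; last 3 first.
- apply/measurable_EFinP; apply: measurable_funD; last exact: measurable_gaussian.
  apply: measurable_funB; last exact: measurable_gaussian.
  apply: measurable_divergence => [||y|y];
    [exact: measurable_gaussian|exact: measurable_gaussian|exact: gaussian_gt0..].
- by move=> y _; rewrite lee_fin xlnx_divergence_ge0// gaussian_gt0.
- by rewrite lee_fin ltW.
by rewrite gaussian_KL// -EFinM mulrC.
Qed.

Transparent gaussian sqnorm dot.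

(** * Orthogonality of gradient and divergence-free fields *)

(** The squared norm of the field in L^2(p). *)
Definition energy {R : realType} d (p : 'rV[R]_d -> R)
    (u : 'rV[R]_d -> 'rV[R]_d) : \bar R :=
  (\int[lebesgue_rV d]_x (sqnorm (u x) * p x)%:E)%E.

Section energy.
Context {R : realType} (d : nat) (p : 'rV[R]_d -> R).
Hypotheses (mp : measurable_fun setT p) (p0 : forall x, 0 < p x).
Implicit Types u v : 'rV[R]_d -> 'rV[R]_d.

Definition measurable_field u := forall i, measurable_fun setT (fun x => u x 0 i).

Lemma measurable_field_add u v : measurable_field u -> measurable_field v ->
  measurable_field (fun x => u x + v x).
Proof.
by move=> mu mv i; under eq_fun do rewrite mxE; exact: measurable_funD.
Qed.

Lemma measurable_field_scale a u :
  measurable_field u -> measurable_field (fun x => a *: u x).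
Proof.
by move=> mu i; under eq_fun do rewrite mxE; exact: measurable_funM.
Qed.

Lemma measurable_field_sub u v : measurable_field u -> measurable_field v ->
  measurable_field (fun x => u x - v x).
Proof.
by move=> mu mv i; under eq_fun do rewrite !mxE; exact: measurable_funB.
Qed.

Let sq0 u x : 0 <= sqnorm (u x) * p x.
Proof. by rewrite mulr_ge0 ?sqnorm_ge0// ltW. Qed.

Lemma energy_ge0 u : (0 <= energy p u)%E.
Proof. by apply: integral_ge0 => x _; rewrite lee_fin. Qed.

Lemma integrable_energy u : measurable_field u ->
  (energy p u < +oo)%E ->
  (lebesgue_rV d).-integrable setT (fun x => (sqnorm (u x) * p x)%:E).
Proof.
move=> mu eu; apply/integrableP; split.
  apply/measurable_EFinP; apply: measurable_funM => //.
  exact: measurable_fun_sqnorm.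
by under eq_integral do rewrite gee0_abs ?lee_fin//.
Qed.

Lemma dot_sqnorm_bound (a b : 'rV[R]_d) : `|dot a b| <= sqnorm a + sqnorm b.
Proof.
rewrite /dot /sqnorm -big_split; apply: le_trans (ler_norm_sum _ _ _) _.
apply: ler_sum => i _ /=; rewrite ler_norml.
by apply/andP; split; nra.
Qed.

Lemma integrable_dot u v : measurable_field u -> measurable_field v ->
  (energy p u < +oo)%E -> (energy p v < +oo)%E ->
  (lebesgue_rV d).-integrable setT (fun x => (dot (u x) (v x) * p x)%:E).
Proof.
move=> mu mv eu ev.
have iuv := integrableD measurableT (integrable_energy mu eu) (integrable_energy mv ev).
apply: le_integrable iuv => //.
  apply/measurable_EFinP; apply: measurable_funM => //.
  exact: measurable_fun_dot.
move=> x _ /=; rewrite lee_fin -mulrDl normrM (gtr0_norm (p0 x)).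
rewrite [leRHS]ger0_norm; last by rewrite mulr_ge0 ?addr_ge0 ?sqnorm_ge0// ltW.
by rewrite ler_pM2r// dot_sqnorm_bound.
Qed.

Lemma energyD u v : measurable_field u -> measurable_field v ->
  (energy p u < +oo)%E -> (energy p v < +oo)%E ->
  (\int[lebesgue_rV d]_x (dot (u x) (v x) * p x)%:E = 0)%E ->
  energy p (fun x => u x + v x) = (energy p u + energy p v)%E.
Proof.
move=> mu mv eu ev uv0.
have iu := integrable_energy mu eu; have iv := integrable_energy mv ev.
have iuv := integrable_dot mu mv eu ev.
rewrite /energy (eq_integral (fun x => (sqnorm (u x) * p x)%:E +
    2%:E * (dot (u x) (v x) * p x)%:E + (sqnorm (v x) * p x)%:E)%E); last first.
  by move=> x _; rewrite -EFinM -!EFinD sqnormD; congr EFin; ring.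
rewrite integralD//; last by apply: integrableD => //; exact: integrableZl.
rewrite integralD//; last exact: integrableZl.
by rewrite integralZl// uv0 mule0 adde0.
Qed.

Lemma sqnormN (a : 'rV[R]_d) : sqnorm (- a) = sqnorm a.
Proof. by apply: eq_bigr => i _; rewrite mxE sqrrN. Qed.

Lemma energyB_lty u v : measurable_field u -> measurable_field v ->
  (energy p u < +oo)%E -> (energy p v < +oo)%E ->
  (energy p (fun x => u x - v x)%R < +oo)%E.
Proof.
move=> mu mv eu ev.
have iu := integrable_energy mu eu; have iv := integrable_energy mv ev.
(* The factor 3 comes from [|u - v|^2 = |u|^2 - 2 u.v + |v|^2] and the bound
   [|u.v| <= |u|^2 + |v|^2]. *)
have i3 := integrableZl measurableT 3 (integrableD measurableT iu iv).
apply: le_lt_trans (integrable_lty measurableT i3).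
apply: ge0_le_integral => //.
- by move=> x _; rewrite lee_fin mulr_ge0 ?sqnorm_ge0 ?ltW.
- apply/measurable_EFinP; apply: measurable_funM => //.
  exact: (measurable_fun_sqnorm (measurable_field_sub mu mv)).
- exact: measurable_int i3.
move=> x _; rewrite -EFinD -EFinM lee_fin -mulrDl mulrA ler_pM2r//.
rewrite sqnormD sqnormN; have := dot_sqnorm_bound (u x) (- v x).
by rewrite sqnormN ler_norml => /andP[_]; lra.
Qed.

End energy.

Lemma C1_measurable {R : realType} d (f : 'rV[R]_d -> R) :
  C1 f -> measurable_fun setT f.
Proof. by move=> cf; apply: continuous_measurable_rV; exact: C1_continuous. Qed.

Lemma C1_field_measurable {R : realType} d (u : 'rV[R]_d -> 'rV[R]_d) :
  C1_field u -> measurable_field u.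
Proof. by move=> cu i; exact: C1_measurable. Qed.

Lemma grad_measurable {R : realType} d (r : 'rV[R]_d -> R) :
  C1 r -> measurable_field (grad r).
Proof.
move=> [_ cr] i; under eq_fun do rewrite mxE; exact: continuous_measurable_rV.
Qed.

Lemma C1_field_sub {R : realType} d (u v : 'rV[R]_d -> 'rV[R]_d) :
  C1_field u -> C1_field v -> C1_field (fun x => u x - v x).
Proof.
move=> cu cv i; rewrite (_ : (fun x => _) = fun x => u x 0 i - v x 0 i).
  exact: C1B.
by apply/funext => x; rewrite !mxE.
Qed.

Lemma gradB {R : realType} d (f g : 'rV[R]_d -> R) x : C1 f -> C1 g ->
  grad (fun y => f y - g y) x = grad f x - grad g x.
Proof.
move=> cf cg; apply/rowP => i; rewrite !mxE partialB//; exact: C1_differentiable.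
Qed.

Lemma divergenceB {R : realType} d (u v : 'rV[R]_d -> 'rV[R]_d) x :
  C1_field u -> C1_field v ->
  divergence (fun y => u y - v y) x = divergence u x - divergence v x.
Proof.
move=> cu cv; rewrite /divergence -sumrB; apply: eq_bigr => i _.
rewrite (_ : (fun y => _) = fun y => u y 0 i - v y 0 i); last first.
  by apply/funext => y; rewrite !mxE.
by rewrite partialB//; exact: C1_differentiable.
Qed.

Section orthogonality.
Context {R : realType} (d : nat) (p : 'rV[R]_d.+1 -> R).
Hypotheses (cp : C1 p) (p0 : forall x, 0 < p x).
Hypothesis bp : vanishing_boundary_terms p.
Let mp : measurable_fun setT p. Proof. exact: C1_measurable. Qed.

Lemma divergence_scale (f : 'rV[R]_d.+1 -> R) (u : 'rV[R]_d.+1 -> 'rV[R]_d.+1) x :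
  C1 f -> C1_field u ->
  divergence (fun y => f y *: u y) x = f x * divergence u x + dot (grad f x) (u x).
Proof.
move=> cf cu; rewrite /divergence /dot mulr_sumr -big_split; apply: eq_bigr => i _.
rewrite (_ : (fun y => _) = fun y => f y * u y 0 i); last first.
  by apply/funext => y; rewrite mxE.
rewrite partialM; [|exact: C1_differentiable|exact: C1_differentiable (cu i)].
by rewrite mxE /= [X in _ + X]mulrC.
Qed.

Lemma C1_field_scale (f : 'rV[R]_d.+1 -> R) (u : 'rV[R]_d.+1 -> 'rV[R]_d.+1) :
  C1 f -> C1_field u -> C1_field (fun x => f x *: u x).
Proof.
move=> cf cu i; rewrite (_ : (fun y => _) = fun y => f y * u y 0 i).
  exact: C1M.
by apply/funext => y; rewrite mxE.
Qed.

Lemma cvg_integral_cube (f : 'rV[R]_d.+1 -> R) :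
  (lebesgue_rV d.+1).-integrable setT (EFin \o f) ->
  (\int[lebesgue_rV d.+1]_(x in cube d.+1 n.+1%:R) (f x)%:E)%E @[n --> \oo] -->
  (\int[lebesgue_rV d.+1]_x (f x)%:E)%E.
Proof.
move=> fi; have mf := measurable_int _ fi.
pose f_ n := (EFin \o f) \_ (cube d.+1 n.+1%:R).
have [] := @dominated_convergence _ _ R (lebesgue_rV d.+1) setT measurableT
  f_ (EFin \o f) (fun x => `|(f x)%:E|)%E.
- move=> n; apply/(measurable_restrictT _ (measurable_cube n.+1%:R)).
  exact: measurable_funTS.
- exact: mf.
- apply: aeW => x _; apply: cvg_near_cst.
  (* Every coordinate is bounded by the sum of all absolute values, which is less than its
     truncation plus one; hence the half-side [n.+1], also positive as the divergence theorem
     requires. *)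
  exists (Num.truncn (\sum_i `|x 0 i|)) => // n /= nx.
  rewrite /f_ /patch mem_set// => k.
  apply: (@le_trans _ _ (\sum_i `|x 0 i|)).
    by rewrite (bigD1 k)//= lerDl sumr_ge0.
  by rewrite (le_trans (ltW (truncnS_gt _)))// ler_nat.
- exact: integrable_abse.
- apply: aeW => x n _; rewrite /f_ /patch.
  by case: ifP => _; rewrite ?abse0 ?abse_ge0.
move=> _ _; apply: cvg_trans; apply: near_eq_cvg; near=> n.
by rewrite [RHS]integral_mkcond.
Unshelve. all: by end_near. Qed.

(** Since [div (p u) = 0], the integrand is the divergence of [r p u]. Its integral over a cube is a
    flux, which tends to 0, while the cubes exhaust the space. *)
Lemma integral_grad_dot (r : 'rV[R]_d.+1 -> R) (u : 'rV[R]_d.+1 -> 'rV[R]_d.+1) :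
  C1 r -> C1_field u -> (forall x, divergence (fun y => p y *: u y) x = 0) ->
  (energy p (grad r) < +oo)%E -> (energy p u < +oo)%E ->
  (\int[lebesgue_rV d.+1]_x (dot (grad r x) (u x) * p x)%:E = 0)%E.
Proof.
move=> cr cu du er eu.
have fi := integrable_dot mp p0 (grad_measurable cr) (C1_field_measurable cu) er eu.
have h := cvg_integral_cube fi.
(* The last integrability condition in [vanishing_boundary_terms] concerns the zero function
   here. *)
have dr0 : (lebesgue_rV d.+1).-integrable setT
    (fun x => (r x * divergence (fun y => p y *: u y) x)%:E).
  under eq_fun do rewrite du mulr0; exact: integrable0.
have := bp cr cu er eu dr0.
set w := fun x => (r x * p x) *: u x.
have cpu := C1_field_scale cp cu.
have wE : w = fun x => r x *: (p x *: u x) by apply/funext => x; rewrite /w scalerA.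
have cw : C1_field w by rewrite wE; exact: C1_field_scale.
have dw x : divergence w x = dot (grad r x) (u x) * p x.
  rewrite wE divergence_scale// du mulr0 add0r /dot mulr_suml.
  by apply: eq_bigr => i _; rewrite !mxE; ring.
move=> flux0.
(* The limit over real half-sides is restricted to the sequence [n.+1]. *)
have {}flux0 : (cube_flux w n.+1%:R)%:E @[n --> \oo] --> 0%E.
  apply: cvg_EFin; first exact: nearW.
  have := cvg_comp _ _ cvgr_idn flux0.
  by rewrite -cvg_shiftS.
apply: (cvg_unique _ h) => //.
apply: cvg_trans flux0; apply: near_eq_cvg; near=> n.
rewrite -divergence_theorem_cube//; apply: eq_integral => x _.
by rewrite dw.
Unshelve. all: by end_near. Qed.

Lemma energy_grad_orthogonal (r : 'rV[R]_d.+1 -> R) (u : 'rV[R]_d.+1 -> 'rV[R]_d.+1) :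
  C1 r -> C1_field u -> (forall x, divergence (fun y => p y *: u y) x = 0) ->
  (energy p (grad r) < +oo)%E -> (energy p u < +oo)%E ->
  energy p (fun x => grad r x + u x) = (energy p (grad r) + energy p u)%E.
Proof.
move=> cr cu du er eu; apply: energyD => //.
- exact: grad_measurable.
- exact: C1_field_measurable.
- exact: integral_grad_dot.
Qed.

End orthogonality.

(** * Projection of the mean local velocity onto the two classes of fields *)

Section projection.
Context {R : realType} (d : nat) (p : 'rV[R]_d.+1 -> R).
Hypotheses (cp : C1 p) (p0 : forall x, 0 < p x).
Hypothesis bp : vanishing_boundary_terms p.
Variables (nu : 'rV[R]_d.+1 -> 'rV[R]_d.+1) (phi : 'rV[R]_d.+1 -> R).
Hypotheses (cnu : C1_field nu) (cphi : C1 phi) (cgphi : C1_field (grad phi)).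
Hypothesis same_divergence : forall x,
  divergence (fun y => p y *: nu y) x = divergence (fun y => p y *: grad phi y) x.
Hypotheses (enu : (energy p nu < +oo)%E) (ephi : (energy p (grad phi) < +oo)%E).
Let w x := nu x - grad phi x.
Let mp : measurable_fun setT p. Proof. exact: C1_measurable. Qed.

Let divergence0B u v : C1_field u -> C1_field v ->
  (forall x, divergence (fun y => p y *: u y) x =
             divergence (fun y => p y *: v y) x) ->
  forall x, divergence (fun y => p y *: (u y - v y)) x = 0.
Proof.
move=> cu cv uv x; rewrite (_ : (fun y => _) =
    fun y => p y *: u y - p y *: v y); last first.
  by apply/funext => y; rewrite scalerBr.
by rewrite divergenceB; [rewrite uv subrr|exact: C1_field_scale..].
Qed.

Let cw : C1_field w. Proof. exact: C1_field_sub. Qed.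

Lemma divergence_residual x :
  divergence (fun y => p y *: (nu y - grad phi y)) x = 0.
Proof. exact: divergence0B. Qed.

Let dw x : divergence (fun y => p y *: w y) x = 0.
Proof. exact: divergence_residual. Qed.

Lemma energy_residual_lty : (energy p (fun x => nu x - grad phi x)%R < +oo)%E.
Proof. by apply: energyB_lty => //; exact: C1_field_measurable. Qed.

Let ew : (energy p w < +oo)%E. Proof. exact: energy_residual_lty. Qed.

(** A competitor at finite distance from [nu] has finite energy itself, as Pythagoras requires;
    competitors at infinite distance satisfy the minimality bounds trivially. *)
Let energy_lty v : measurable_field v ->
  (energy p (fun x => nu x - v x)%R < +oo)%E -> (energy p v < +oo)%E.
Proof.
move=> mv e; have mnu := C1_field_measurable cnu.
have -> : v = fun x => nu x - (nu x - v x).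
  by apply/funext => x; rewrite subKr.
by apply: energyB_lty => //; exact: measurable_field_sub.
Qed.

Lemma energy_pythagoras :
  energy p nu = (energy p (grad phi) + energy p (fun x => nu x - grad phi x)%R)%E.
Proof.
rewrite -(energy_grad_orthogonal cp p0 bp cphi cw dw ephi ew).
by congr energy; apply/funext => x; rewrite addrC subrK.
Qed.

Lemma energy_zero_divergence_min v : C1_field v ->
  (forall x, divergence (fun y => p y *: v y) x = 0) ->
  (energy p (grad phi) <= energy p (fun x => nu x - v x)%R)%E.
Proof.
move=> cv dv.
have [->|] := eqVneq (energy p (fun x => nu x - v x)%R) +oo%E; first exact: leey.
rewrite -ltey => /(energy_lty (C1_field_measurable cv)) ev.
have -> : (fun x => nu x - v x) = fun x => grad phi x + (w x - v x).
  by apply/funext => x; rewrite /w addrA subrKC.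
have cwv : C1_field (fun x => w x - v x) by exact: C1_field_sub.
have dwv x : divergence (fun y => p y *: (w y - v y)) x = 0.
  by apply: divergence0B => // y; rewrite dw dv.
have ewv : (energy p (fun x => w x - v x)%R < +oo)%E.
  by apply: energyB_lty => //; exact: C1_field_measurable.
rewrite (energy_grad_orthogonal cp p0 bp cphi cwv dwv ephi ewv).
by rewrite leeDl// energy_ge0.
Qed.

Lemma energy_gradient_min r : C1 r ->
  (energy p (fun x => nu x - grad phi x)%R <= energy p (fun x => nu x - grad r x)%R)%E.
Proof.
move=> cr.
have [->|] := eqVneq (energy p (fun x => nu x - grad r x)%R) +oo%E; first exact: leey.
rewrite -ltey => /(energy_lty (grad_measurable cr)) er.
have cs : C1 (fun x => phi x - r x) by exact: C1B.
have gs : grad (fun x => phi x - r x) = fun x => grad phi x - grad r x.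
  by apply/funext => x; exact: gradB.
have es : (energy p (grad (fun x => phi x - r x)%R) < +oo)%E.
  by rewrite gs; apply: energyB_lty => //; exact: grad_measurable.
have -> : (fun x => nu x - grad r x) = fun x => grad (fun y => phi y - r y) x + w x.
  by apply/funext => x; rewrite gs /w [RHS]addrC addrA subrK.
rewrite (energy_grad_orthogonal cp p0 bp cs cw dw es ew).
by rewrite leeDr// energy_ge0.
Qed.

End projection.

(** * The two variational formulas *)

Lemma ereal_inf_min {R : realType} (S : set (\bar R)) (a : \bar R) :
  S a -> (forall x, S x -> (a <= x)%E) -> ereal_inf S = a.
Proof.
move=> Sa lb; apply/eqP; rewrite eq_le ereal_inf_lbound//=.
by apply: le_ereal_inf_tmp.
Qed.

Lemma EFin_mulDBl {R : realType} (c : R) (a b : \bar R) :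
  a \is a fin_num -> b \is a fin_num ->
  (c%:E * (a + b) - c%:E * a = c%:E * b)%E.
Proof.
move: a b => [a| |] [b| |]// _ _.
rewrite -[LHS]/((c * (a + b) - c * a)%:E) -[RHS]/((c * b)%:E).
by congr EFin; ring.
Qed.

(** * From path densities to energies *)

Section velocity.
Context {R : realType} (d : nat) (mu T : R).
Context (F : R -> 'rV[R]_d -> 'rV[R]_d) (P : R -> 'rV[R]_d -> R) (tau : R).
Hypotheses (mu0 : 0 < mu) (T0 : 0 < T).
Hypotheses (p0 : forall x, 0 < P tau x) (cp : C2 (P tau)).
Hypothesis cF : C1_field (F tau).
Local Notation nu := (mean_local_velocity mu T F P tau).

(** Positivity gives [grad (ln P) = grad P / P], and second derivatives of [P] make this quotient
    C^1. *)
Lemma C1_mean_local_velocity : C1_field nu.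
Proof.
move=> i; have [cp1 cgp] := cp.
rewrite (_ : (fun x => _) = fun x =>
    mu * (F tau x 0 i - T * ((P tau x)^-1 * partial i (P tau) x))).
  apply: C1M; first exact: C1_cst.
  apply: C1B; first exact: cF.
  apply: C1M; first exact: C1_cst.
  apply: C1M; first exact: C1V.
  by have := cgp i; under eq_fun do rewrite mxE.
apply/funext => x; rewrite !mxE partial_ln//.
exact: C1_differentiable.
Qed.

(** Both transitions are Gaussians with [s = 4 mu T dt], and their means differ by [dt (v - nu)].
    The divergence is thus [dt / (4 mu T)] times the energy, and the factor [4 / dt] removes the
    time step. *)
Lemma KL_path_density (dt : R) (v : 'rV[R]_d -> 'rV[R]_d) :
  0 < dt -> (\int[lebesgue_rV d]_x (P tau x)%:E = 1)%E -> measurable_field v ->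
  ((4 / dt)%:E * KL (forward_path_density mu T F P tau dt)
      (path_density mu T F P tau dt v) =
   (mu * T)^-1%:E * energy (P tau) (fun x => (nu x - v x)%R))%E.
Proof.
move=> dt0 ip mv.
have mnu := C1_field_measurable C1_mean_local_velocity.
have mF := C1_field_measurable cF.
have mp := C1_measurable (cp.1).
pose s := 4 * mu * T * dt.
have s0 : 0 < s by rewrite !mulr_gt0.
pose m x := x + (mu * dt) *: F tau x.
pose c x := dt *: (v x - nu x).
have mm : measurable_field m.
  apply: measurable_field_add; first by move=> i; exact: measurable_rV_coord.
  exact: measurable_field_scale.
have mvnu : measurable_field (fun x => nu x - v x) by exact: measurable_field_sub.
have mc : measurable_field c.
  by apply: measurable_field_scale; exact: measurable_field_sub.
have transE u x y : transition mu T F P tau dt u y x =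
    gaussian s (m x + dt *: (u x - nu x)) y.
  rewrite /transition /gaussian; move: (dt *: _) => w.
  have -> : 4 * pi * mu * T * dt = pi * s by rewrite /s; ring.
  by have -> : y - x - (mu * dt) *: F tau x - w = y - (m x + w)
    by rewrite /m !opprD !addrA.
have -> : forward_path_density mu T F P tau dt =
    fun z => gaussian s (m z.2) z.1 * P tau z.2.
  apply/funext => z; rewrite /forward_path_density /path_density transE.
  by rewrite subrr scaler0 addr0.
have -> : path_density mu T F P tau dt v =
    fun z => gaussian s (m z.2 + c z.2) z.1 * P tau z.2.
  by apply/funext => z; rewrite /path_density transE.
rewrite KL_gaussian_kernel//.
have e0 x : 0 <= sqnorm (nu x - v x) * P tau x.
  by rewrite mulr_ge0 ?sqnorm_ge0// ltW.
have mE : measurable_fun setT (fun x => (sqnorm (nu x - v x) * P tau x)%:E).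
  apply/measurable_EFinP; apply: measurable_funM => //.
  exact: measurable_fun_sqnorm.
rewrite (eq_integral (fun x => (dt / (4 * mu * T))%:E *
    (sqnorm (nu x - v x) * P tau x)%:E)%E); last first.
  move=> x _; rewrite -EFinM; congr EFin.
  rewrite /c sqnormZ -sqnormN opprB mulrA; congr (_ * _).
  by rewrite /s; field; rewrite !gt_eqF.
rewrite ge0_integralZl//; last 2 first.
- by move=> x _; rewrite lee_fin.
- by rewrite lee_fin ltW// divr_gt0// !mulr_gt0.
rewrite muleA -EFinM; congr (_%:E * _)%E.
by field; rewrite !gt_eqF.
Qed.

(** For every [dt > 0] the infimum is attained at [v0] with a value independent of [dt], so the
    limit is that of a constant. A general class [M] covers both manifolds. *)
Lemma ereal_inf_KL_cvg (M : set ('rV[R]_d -> 'rV[R]_d)) (v0 : 'rV[R]_d -> 'rV[R]_d) :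
  (\int[lebesgue_rV d]_x (P tau x)%:E = 1)%E ->
  (forall v, M v -> measurable_field v) -> M v0 ->
  (forall v, M v -> energy (P tau) (fun x => nu x - v0 x)%R <=
                    energy (P tau) (fun x => nu x - v x)%R)%E ->
  ereal_inf [set ((4 / dt)%:E * KL (forward_path_density mu T F P tau dt) Q)%E
            | Q in [set path_density mu T F P tau dt v | v in M]]
    @[dt --> (0 : R)^'+] -->
  ((mu * T)^-1%:E * energy (P tau) (fun x => nu x - v0 x)%R)%E.
Proof.
move=> ip mM Mv0 minv0; apply: cvg_near_cst.
near=> dt.
have dt0 : 0 < dt by near: dt; exact: nbhs_right_gt.
apply: ereal_inf_min.
  exists (path_density mu T F P tau dt v0); first by exists v0.
  by apply: KL_path_density => //; exact: mM.
move=> _ [_ [v Mv <-] <-]; rewrite KL_path_density//; last exact: mM.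
by rewrite lee_pmul2l ?minv0// lte_fin invr_gt0 mulr_gt0.
Unshelve. all: by end_near. Qed.

End velocity.

Theorem proposition21 (R : realType) (d : nat) (mu T : R)
  (F : R -> 'rV[R]_d -> 'rV[R]_d) (P : R -> 'rV[R]_d -> R)
  (t0 t1 tau : R) (phi : 'rV[R]_d -> R)
  (hd : (0 < d)%N) (hmu : 0 < mu) (hT : 0 < T) (htau : t0 < tau < t1)
  (hP : forall t, t0 < t < t1 -> prob_density (P t))
  (hPpos : forall t x, t0 < t < t1 -> 0 < P t x)
  (hPreg : forall t, t0 < t < t1 -> C2 (P t))
  (hFreg : forall t, t0 < t < t1 -> C1_field (F t))
  (hFP : forall t, t0 < t < t1 ->
     continuity_equation P t (mean_local_velocity mu T F P t))
  (hsigma : (\int[lebesgue_rV d]_x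
     (sqnorm (mean_local_velocity mu T F P tau x) * P tau x)%:E < +oo)%E)
  (hphireg : C2 phi)
  (hphi : continuity_equation P tau (grad phi))
  (hphifin : (\int[lebesgue_rV d]_x
     (sqnorm (grad phi x) * P tau x)%:E < +oo)%E)
  (hW2 : W2_speed2 P tau h @[h --> (0 : R)^'] -->
     (\int[lebesgue_rV d]_x (sqnorm (grad phi x) * P tau x)%:E)%E)
  (hdecay : vanishing_boundary_terms (P tau)) :
  ereal_inf [set ((4 / dt)%:E * KL (forward_path_density mu T F P tau dt) Q)%E
            | Q in zero_divergence_manifold mu T F P tau dt]
    @[dt --> (0 : R)^'+] --> sigma_ex mu T P tau
  /\
  ereal_inf [set ((4 / dt)%:E * KL (forward_path_density mu T F P tau dt) Q)%E
            | Q in gradient_manifold mu T F P tau dt]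
    @[dt --> (0 : R)^'+] --> sigma_hk mu T F P tau.
Proof.
(* Positive dimension is written as a successor, the form in which cubes have faces in the
   divergence theorem. *)
case: d => // d in F P phi hd hP hPpos hPreg hFreg hFP hsigma hphireg hphi hphifin hW2 hdecay *.
have [mp _ ip] := hP _ htau.
have p0 x : 0 < P tau x by exact: hPpos.
have cp := hPreg _ htau; have cp1 := cp.1.
have cF := hFreg _ htau.
have cnu := C1_mean_local_velocity mu T p0 cp cF.
have hFPtau := hFP _ htau.
have KLc := ereal_inf_KL_cvg hmu hT p0 cp cF.
(* The Wasserstein limit in [sigma_ex] is the energy of [grad phi] by [hW2]. *)
rewrite /sigma_hk /sigma /sigma_ex (cvg_lim _ hW2)//.
rewrite -/(energy (P tau) (grad phi)) -/(energy (P tau) (mean_local_velocity _ _ _ _ _)).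
move: (mean_local_velocity mu T F P tau) hsigma hFPtau cnu KLc => nu enu hnu cnu KLc.
have cphi := hphireg.1; have cgphi : C1_field (grad phi) := hphireg.2.
have same_div x : divergence (fun y => P tau y *: nu y) x =
    divergence (fun y => P tau y *: grad phi y) x.
  (* Both continuity equations compute the same time derivative of the density, and derivatives are
     unique. *)
  apply: oppr_inj.
  by rewrite -(@derive_val _ _ _ _ _ _ _ (hnu x)) (@derive_val _ _ _ _ _ _ _ (hphi x)).
have zd := energy_zero_divergence_min cp1 p0 hdecay cnu cphi cgphi same_div enu hphifin.
have gd := energy_gradient_min cp1 p0 hdecay cnu cphi cgphi same_div enu hphifin.
have py := energy_pythagoras cp1 p0 hdecay cnu cphi cgphi same_div enu hphifin.
pose w x := nu x - grad phi x.
have nuwE : (fun x => nu x - w x) = grad phi by apply/funext => x; rewrite /w subKr.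
split.
(* The minimiser is the residual [w], at distance [grad phi] from [nu]. *)
- rewrite -nuwE; apply: KLc => //.
  + by move=> v [cv _]; exact: C1_field_measurable.
  + split; first exact: C1_field_sub.
    exact: divergence_residual.
  by move=> v [cv dv]; rewrite nuwE; exact: zd.
- have ew : (energy (P tau) w < +oo)%E by exact: (energy_residual_lty cp1).
  (* By Pythagoras the difference defining [sigma_hk] is the energy of the residual; the subtraction
     is sound because both energies are finite. *)
  have -> : ((mu * T)^-1%:E * energy (P tau) nu -
      (mu * T)^-1%:E * energy (P tau) (grad phi) = (mu * T)^-1%:E * energy (P tau) w)%E.
    rewrite py -/w; apply: EFin_mulDBl; rewrite ge0_fin_numE ?energy_ge0//.
  (* The manifold is indexed by potentials; it is re-indexed by gradient fields to fit
     [ereal_inf_KL_cvg]. *)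
  rewrite (_ : gradient_manifold mu T F P tau =
      fun dt => [set path_density mu T F P tau dt v | v in [set grad r | r in [set r | C1 r]]]);
    last by apply/funext => dt; rewrite image_comp.
  apply: KLc => //.
  + by move=> _ [r cr <-]; exact: grad_measurable.
  + by exists phi.
  by move=> _ [r cr <-]; exact: gd.
Qed.
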